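(* Let $Y$ be a Banach space and $K$ an infinite compact Hausdorff space. Suppose that the dual space $Y^*$ contains $C(K)$ (isometrically) as a closed subspace. If the pair $(K,Y^* )$ has the continuous extension property, then $C(K)$ is complemented in its second dual $C(K)^{**}$. In particular, in this case $C(K)$ has the Grothendieck property and contains an isomorphic copy of $\ell^\infty$.
   Context: For $t\in K$, $\delta_t\in C(K)^*$ is the Dirac functional $\delta_t(a)=a(t)$. For a Banach space $Z$ containing $C(K)$ isometrically as a closed subspace, the pair $(K,Z)$ has the continuous extension property if there is a map $\rho:K\to Z^*$, continuous for the weak-star topology of $Z^*$, such that for each $t\in K$ the functional $\rho(t)$ is a norm-preserving extension of $\delta_t$ to $Z$ (i.e. $\rho(t)|_{C(K)}=\delta_t$ and $\|\rho(t)\|=1$). A Banach space is regarded as canonically embedded in its second dual; it is complemented there if it is the range of a bounded linear projection. A Banach space $X$ has the Grothendieck property if every weak-star convergent sequence in $X^*$ converges weakly. An isomorphic copy of $\ell^\infty$ is a closed subspace linearly homeomorphic to $\ell^\infty$. *)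

(* Defs.v *)
From HB Require Import structures.
From mathcomp Require Import all_boot all_order all_algebra.
From mathcomp Require Import all_classical all_reals all_analysis.
From mathcomp Require Import complex.

Set Implicit Arguments.
Unset Strict Implicit.
Unset Printing Implicit Defensive.

Import Order.TTheory GRing.Theory Num.Theory.
Import numFieldNormedType.Exports.

Local Open Scope classical_set_scope.
Local Open Scope ring_scope.

(* Banach spaces are considered over the real or over the complex numbers.
   Over [R[i]] the norm of a [normedModType R[i]] takes its values in the
   nonnegative reals of [R[i]], so [ofreal] and [modulus] mediate between the
   field and [R], where suprema are taken. *)
Variant scalars := RealScalars | ComplexScalars.

Definition scalar_field (R : realType) (s : scalars) : numFieldType :=
  match s with
  | RealScalars => R : numFieldType
  | ComplexScalars => R[i] : numFieldType
  end.

Definition ofreal (R : realType) (s : scalars) : R -> scalar_field R s :=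
  match s return R -> scalar_field R s with
  | RealScalars => fun r => r
  | ComplexScalars => fun r => r%:C%C
  end.

Definition modulus (R : realType) (s : scalars) : scalar_field R s -> R :=
  match s return scalar_field R s -> R with
  | RealScalars => fun r : R => `|r|
  | ComplexScalars => fun z : R[i] => ComplexField.Normc.normc z
  end.

Section scalar_theory.
Context {R : realType} {s : scalars}.
Local Notation F := (scalar_field R s).
Implicit Types (a b : R) (x y z : F).

Lemma ofreal_modulus z : ofreal s (modulus z) = `|z|.
Proof. by case: s z. Qed.

Lemma ler_ofreal a b : (ofreal s a <= ofreal s b) = (a <= b).
Proof. by case: s => //=; rewrite lecR. Qed.

Lemma ofrealD a b : ofreal s (a + b) = ofreal s a + ofreal s b.
Proof. by case: s => //=; rewrite rmorphD. Qed.

Lemma ofrealM a b : ofreal s (a * b) = ofreal s a * ofreal s b.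
Proof. by case: s => //=; rewrite rmorphM. Qed.

Lemma ofreal0 : ofreal s (0 : R) = 0.
Proof. by case: s. Qed.

Lemma ofreal1 : ofreal s (1 : R) = 1.
Proof. by case: s. Qed.

Lemma ofreal_inj : injective (@ofreal R s).
Proof. by move=> a b ab; apply/eqP; rewrite eq_le -!ler_ofreal ab lexx. Qed.

Lemma modulus_ge0 z : 0 <= modulus z.
Proof. by rewrite -ler_ofreal ofreal0 ofreal_modulus. Qed.

Lemma modulusD x y : modulus (x + y) <= modulus x + modulus y.
Proof. by rewrite -ler_ofreal ofrealD !ofreal_modulus ler_normD. Qed.

Lemma modulusM x y : modulus (x * y) = modulus x * modulus y.
Proof. by apply: ofreal_inj; rewrite ofrealM !ofreal_modulus normrM. Qed.

Lemma modulus_eq0 z : modulus z = 0 -> z = 0.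
Proof. by move=> z0; apply/normr0_eq0; rewrite -ofreal_modulus z0 ofreal0. Qed.

End scalar_theory.

Definition supnorm (R : realType) (s : scalars) (T : Type) (D : set T)
    (f : T -> scalar_field R s) : scalar_field R s :=
  ofreal s (sup [set modulus (f x) | x in D]).

Section supnorm_theory.
Context {R : realType} {s : scalars} {T : Type} {D : set T}.
Local Notation F := (scalar_field R s).
Implicit Types f g : T -> F.

Definition modulus_bounded f := exists M : R, forall x, D x -> modulus (f x) <= M.

Lemma modulus_le_supnorm f x : modulus_bounded f -> D x ->
  `|f x| <= supnorm D f.
Proof.
move=> [M fM] Dx; rewrite -ofreal_modulus ler_ofreal.
apply: ub_le_sup; last by exists x.
by exists M => _ [y Dy <-]; exact: fM.
Qed.

Lemma supnorm_le f (M : R) : 0 <= M ->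
  (forall x, D x -> modulus (f x) <= M) -> supnorm D f <= ofreal s M.
Proof.
move=> M0 fM; rewrite ler_ofreal.
have [->|/set0P D0] := eqVneq D set0; first by rewrite image_set0 sup0.
by apply: ge_sup; [case: D0 => x Dx; exists (modulus (f x)), x|
  move=> _ [y Dy <-]; exact: fM].
Qed.

Lemma supnorm_ge0 f : modulus_bounded f -> 0 <= supnorm D f.
Proof.
have [->|/set0P[x Dx]] := eqVneq D set0.
  by rewrite /supnorm image_set0 sup0 ofreal0.
by move=> bf; exact: le_trans (normr_ge0 (f x)) (modulus_le_supnorm bf Dx).
Qed.

Lemma sup_modulus_ge0 f : modulus_bounded f ->
  0 <= sup [set modulus (f x) | x in D].
Proof. by move=> /supnorm_ge0; rewrite -(@ofreal0 R s) ler_ofreal. Qed.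

Lemma supnorm_eq0 f : modulus_bounded f -> supnorm D f = 0 ->
  forall x, D x -> f x = 0.
Proof.
move=> bf f0 x Dx; apply/normr0_eq0/le_anti.
by rewrite normr_ge0 -f0 modulus_le_supnorm.
Qed.

Lemma supnormD f g : modulus_bounded f -> modulus_bounded g ->
  supnorm D (fun x => f x + g x) <= supnorm D f + supnorm D g.
Proof.
move=> bf bg; rewrite -ofrealD; apply: supnorm_le => [|x Dx].
  by rewrite addr_ge0// sup_modulus_ge0.
rewrite -(@ler_ofreal R s) ofreal_modulus ofrealD (le_trans (ler_normD _ _))//.
by rewrite lerD// modulus_le_supnorm.
Qed.

Lemma supnormZ_le (c : F) f : modulus_bounded f ->
  supnorm D (fun x => c * f x) <= `|c| * supnorm D f.
Proof.
move=> bf; rewrite -ofreal_modulus -ofrealM; apply: supnorm_le => [|x Dx].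
  by rewrite mulr_ge0 ?modulus_ge0// sup_modulus_ge0.
rewrite -(@ler_ofreal R s) ofreal_modulus ofrealM normrM ofreal_modulus.
by rewrite ler_wpM2l// modulus_le_supnorm.
Qed.

Lemma supnormZ (c : F) f : modulus_bounded f ->
  supnorm D (fun x => c * f x) = `|c| * supnorm D f.
Proof.
move=> bf; apply/le_anti; rewrite supnormZ_le//=.
have [->|c0] := eqVneq c 0; first rewrite normr0 mul0r supnorm_ge0//.
  by exists 0 => x _; rewrite mul0r -(@ler_ofreal R s) ofreal_modulus normr0 ofreal0.
have bcf : modulus_bounded (fun x => c * f x).
  have [M fM] := bf; exists (modulus c * M) => x Dx.
  by rewrite modulusM ler_wpM2l ?modulus_ge0// fM.
have := supnormZ_le c^-1 bcf.
rewrite (_ : (fun _ => _) = f); last by apply/funext => x; rewrite mulKf.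
by rewrite normfV ler_pdivlMl// normr_gt0.
Qed.

End supnorm_theory.
Arguments modulus_bounded {R s T} D f.

Section dual.
Context {R : realType} {s : scalars}.
Local Notation F := (scalar_field R s).
Variable X : normedModType F.

Definition dual_pred : {pred X -> F^o} :=
  [pred f : X -> F^o | `[< linear f /\ continuous f >]].

Lemma dual_submod_closed : submod_closed dual_pred.
Proof.
split=> [|c f g].
  rewrite inE; split=> [a x y|]; first by rewrite scaler0 addr0.
  exact: cst_continuous.
rewrite !inE => -[lf cf] [lg cg]; split=> [a x y|x].
  have e z : (c *: f + g) z = c *: f z + g z by [].
  by rewrite !e lf lg !scalerDr !scalerA (mulrC c) addrACA.
apply: (@continuousD _ _ _ (fun x => c *: f x) g); last exact: cg.
by apply: (@continuousZl_tmp _ _ _ f); exact: cf.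
Qed.

HB.instance Definition _ :=
  GRing.isSubmodClosed.Build F (X -> F^o) dual_pred dual_submod_closed.

Record dual : Type := Dual { dual_fun :> X -> F^o; _ : dual_fun \in dual_pred }.

HB.instance Definition _ := [isSub for dual_fun].
HB.instance Definition _ := [Choice of dual by <:].
HB.instance Definition _ := [SubChoice_isSubLmodule of dual by <:].

Lemma dualP (f : dual) : linear f /\ continuous f.
Proof. by case: f => f /=; rewrite inE. Qed.

HB.instance Definition _ (f : dual) :=
  GRing.isLinear.Build F X F^o *:%R f (dualP f).1.

Lemma dual_bounded (f : dual) :
  exists2 M : R, 0 <= M & forall x, `|f x| <= ofreal s M * `|x|.
Proof.
have /pinfty_ex_gt0[r r0 fr] := (linear_boundedP f).1
  ((linear_bounded_continuous f).2 (dualP f).2).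
exists (modulus r) => [|x]; first exact: modulus_ge0.
by rewrite ofreal_modulus (gtr0_norm r0); have := fr x.
Qed.

Definition unit_ball : set X := [set x | `|x| <= 1].

Lemma dual_modulus_bounded (f : dual) : modulus_bounded unit_ball f.
Proof.
have [M M0 fM] := dual_bounded f; exists M => x x1.
rewrite -(@ler_ofreal R s) ofreal_modulus (le_trans (fM x))//.
by rewrite ler_piMr// -(@ofreal0 R s) ler_ofreal.
Qed.

Definition dual_norm (f : dual) : F := supnorm unit_ball f.

Lemma dual_normD (f g : dual) : dual_norm (f + g) <= dual_norm f + dual_norm g.
Proof.
exact: (supnormD (dual_modulus_bounded f) (dual_modulus_bounded g)).
Qed.

Lemma dual_normZ (c : F) (f : dual) : dual_norm (c *: f) = `|c| * dual_norm f.
Proof. by rewrite /dual_norm -(supnormZ c (dual_modulus_bounded f)). Qed.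

Lemma dual_norm_eq0 (f : dual) : dual_norm f = 0 -> f = 0.
Proof.
move=> /(supnorm_eq0 (dual_modulus_bounded f)) f0.
apply/val_inj/funext => x /=; have [->|x0] := eqVneq x 0.
  by rewrite linear0.
have : f (`|x|^-1 *: x) = 0.
  by apply: f0; rewrite /unit_ball/= normrZ normfV normr_id mulVf// normr_eq0.
rewrite linearZ/= => /eqP; rewrite scaler_eq0 invr_eq0 normr_eq0 (negbTE x0).
by move=> /eqP.
Qed.

HB.instance Definition _ :=
  Lmodule_isNormed.Build F dual dual_normD dual_normZ dual_norm_eq0.

Lemma ler_dual_norm (f : dual) x : `|f x| <= `|f| * `|x|.
Proof.
have [->|x0] := eqVneq x 0; first by rewrite linear0 !normr0 mulr0.
have : `|f (`|x|^-1 *: x)| <= `|f|.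
  apply: modulus_le_supnorm; first exact: dual_modulus_bounded.
  by rewrite /unit_ball/= normrZ normfV normr_id mulVf// normr_eq0.
rewrite linearZ/= normrZ normfV normr_id mulrC ler_pdivrMr// normr_gt0//.
Qed.

End dual.

Section mk_dual.
Context {R : realType} {s : scalars} {X : normedModType (scalar_field R s)}.
Local Notation F := (scalar_field R s).

Lemma bounded_in_dual (f : X -> F^o) (M : F) : linear f -> 0 <= M ->
  (forall x, `|f x| <= M * `|x|) -> f \in @dual_pred R s X.
Proof.
move=> lf M0 fM; rewrite inE; split=> //.
pose g : {linear X -> F^o} := HB.pack f (GRing.isLinear.Build F X F^o *:%R f lf).
apply: (@bounded_linear_continuous _ _ _ g); apply/linear_boundedP.
near=> r => x; rewrite (le_trans (fM x))// ler_wpM2r//.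
by near: r; apply: nbhs_pinfty_ge; exact: ger0_real.
Unshelve. all: by end_near. Qed.

End mk_dual.

Section canonical_embedding.
Context {R : realType} {s : scalars} (X : normedModType (scalar_field R s)).
Local Notation F := (scalar_field R s).

Lemma eval_in_dual (x : X) :
  (fun f : dual X => f x : F^o) \in @dual_pred R s (dual X).
Proof.
apply: (@bounded_in_dual _ _ _ _ `|x|) => // f.
by rewrite mulrC ler_dual_norm.
Qed.

Definition canonical_embedding (x : X) : dual (dual X) := Dual (eval_in_dual x).

End canonical_embedding.

(* [weak_star X] is [dual X] with the topology of pointwise convergence on [X],
   and [weak X] is [X] with the topology of pointwise convergence on [dual X];
   both are aliases that hide the norm topology. *)
Definition weak_star (R : realType) (s : scalars)
    (X : normedModType (scalar_field R s)) : Type :=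
  initial_topology (fun f : dual X => (f : {ptws X -> (scalar_field R s)^o})).

HB.instance Definition _ (R : realType) (s : scalars)
  (X : normedModType (scalar_field R s)) := Topological.on (weak_star X).

Definition weak (R : realType) (s : scalars)
    (X : normedModType (scalar_field R s)) : Type :=
  initial_topology
    (fun x : X => (canonical_embedding x : {ptws dual X -> (scalar_field R s)^o})).

HB.instance Definition _ (R : realType) (s : scalars)
  (X : normedModType (scalar_field R s)) := Topological.on (weak X).

HB.mixin Record isCompactHausdorff K & Topological K := {
  compactT : compact [set: K];
  hausdorffT : hausdorff_space K
}.

#[short(type="compactHausdorffType")]
HB.structure Definition CompactHausdorff :=
  { K of Topological K & isCompactHausdorff K }.

Section cspace.
Context {R : realType} {s : scalars}.
Local Notation F := (scalar_field R s).
Variable K : compactHausdorffType.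

Definition cspace_pred : {pred K -> F^o} :=
  [pred a : K -> F^o | `[< continuous a >]].

Lemma cspace_submod_closed : submod_closed cspace_pred.
Proof.
split=> [|c a b]; first by rewrite inE; exact: cst_continuous.
rewrite !inE => ca cb t.
apply: (@continuousD _ _ _ (fun t => c *: a t) b); last exact: cb.
by apply: (@continuousZl_tmp _ _ _ a); exact: ca.
Qed.

HB.instance Definition _ :=
  GRing.isSubmodClosed.Build F (K -> F^o) cspace_pred cspace_submod_closed.

Record cspace : Type :=
  CSpace { cspace_fun :> K -> F^o; _ : cspace_fun \in cspace_pred }.

HB.instance Definition _ := [isSub for cspace_fun].
HB.instance Definition _ := [Choice of cspace by <:].
HB.instance Definition _ := [SubChoice_isSubLmodule of cspace by <:].

Lemma cspace_continuous (a : cspace) : continuous a.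
Proof. by case: a => a /=; rewrite inE. Qed.

Lemma cspace_modulus_bounded (a : cspace) : modulus_bounded [set: K] a.
Proof.
have /compact_near_coveringP/(_ R +oo_R
  (fun M t => modulus (a t) <= M)) := @compactT K.
case=> [t _|M [_ aM]]; last by exists (M + 1) => t _; apply: aM => //; rewrite ltrDl.
have at1 : \forall t' \near t, modulus (a t') <= modulus (a t) + 1.
  have : \forall t' \near t, `|a t - a t'| < 1.
    by have /cvgr_dist_lt := @cspace_continuous a t; apply.
  apply: filterS => t' att'.
  rewrite -(@ler_ofreal R s) ofreal_modulus ofrealD ofreal_modulus ofreal1.
  by rewrite -lerBlDl (le_trans (lerB_dist _ _))// distrC ltW.
exists ([set t' | modulus (a t') <= modulus (a t) + 1],
        [set M | modulus (a t) + 1 <= M]) => /=.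
  by split=> //; apply: nbhs_pinfty_ge; exact: num_real.
by move=> [t' M] [/=]; exact: le_trans.
Qed.

Definition cspace_norm (a : cspace) : F := supnorm [set: K] a.

Lemma cspace_normD (a b : cspace) :
  cspace_norm (a + b) <= cspace_norm a + cspace_norm b.
Proof.
exact: (supnormD (cspace_modulus_bounded a) (cspace_modulus_bounded b)).
Qed.

Lemma cspace_normZ (c : F) (a : cspace) :
  cspace_norm (c *: a) = `|c| * cspace_norm a.
Proof. by rewrite /cspace_norm -(supnormZ c (cspace_modulus_bounded a)). Qed.

Lemma cspace_norm_eq0 (a : cspace) : cspace_norm a = 0 -> a = 0.
Proof.
move=> /(supnorm_eq0 (cspace_modulus_bounded a)) a0.
by apply/val_inj/funext => t; exact: a0.
Qed.

HB.instance Definition _ :=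
  Lmodule_isNormed.Build F cspace cspace_normD cspace_normZ cspace_norm_eq0.

Lemma dirac_in_dual (t : K) : (fun a : cspace => a t) \in @dual_pred R s cspace.
Proof.
apply: (@bounded_in_dual _ _ _ _ 1) => // a; rewrite mul1r.
by apply: modulus_le_supnorm => //; exact: cspace_modulus_bounded.
Qed.

Definition dirac_functional (t : K) : dual cspace := Dual (dirac_in_dual t).

End cspace.
Arguments cspace R s K : clear implicits.

Section linfty.
Variables (R : realType) (s : scalars).
Local Notation F := (scalar_field R s).

Definition linfty_pred : {pred nat -> F^o} :=
  [pred u : nat -> F^o | `[< bounded_fun u >]].

Lemma linfty_predP (u : nat -> F^o) :
  reflect (modulus_bounded [set: nat] u) (u \in linfty_pred).
Proof.
apply: (iffP idP); rewrite inE.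
  move=> /pinfty_ex_gt0[M M0 uM]; exists (modulus M) => n _.
  rewrite -(@ler_ofreal R s) !ofreal_modulus (gtr0_norm M0).
  exact: uM.
move=> [M uM]; apply/(@ex_bound _ _ _ _ (globally setT)).
  exact: (@globally_properfilter _ _ 0%N).
exists (ofreal s M) => n _ /=.
by have := uM n I; rewrite -(@ler_ofreal R s) ofreal_modulus.
Qed.

Lemma linfty_submod_closed : submod_closed linfty_pred.
Proof.
split=> [|c u v].
  apply/linfty_predP; exists 0 => n _.
  by rewrite -(@ler_ofreal R s) ofreal_modulus normr0 ofreal0.
move=> /linfty_predP[M uM] /linfty_predP[N vN]; apply/linfty_predP.
exists (modulus c * M + N) => n _.
rewrite (le_trans (modulusD _ _))// lerD ?vN// modulusM ler_wpM2l ?uM//.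
exact: modulus_ge0.
Qed.

HB.instance Definition _ :=
  GRing.isSubmodClosed.Build F (nat -> F^o) linfty_pred linfty_submod_closed.

Record linfty : Type :=
  Linfty { linfty_fun :> nat -> F^o; _ : linfty_fun \in linfty_pred }.

HB.instance Definition _ := [isSub for linfty_fun].
HB.instance Definition _ := [Choice of linfty by <:].
HB.instance Definition _ := [SubChoice_isSubLmodule of linfty by <:].

Lemma linfty_modulus_bounded (u : linfty) : modulus_bounded [set: nat] u.
Proof. by apply/linfty_predP; case: u. Qed.

Definition linfty_norm (u : linfty) : F := supnorm [set: nat] u.

Lemma linfty_normD (u v : linfty) :
  linfty_norm (u + v) <= linfty_norm u + linfty_norm v.
Proof.
exact: (supnormD (linfty_modulus_bounded u) (linfty_modulus_bounded v)).
Qed.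

Lemma linfty_normZ (c : F) (u : linfty) :
  linfty_norm (c *: u) = `|c| * linfty_norm u.
Proof. by rewrite /linfty_norm -(supnormZ c (linfty_modulus_bounded u)). Qed.

Lemma linfty_norm_eq0 (u : linfty) : linfty_norm u = 0 -> u = 0.
Proof.
move=> /(supnorm_eq0 (linfty_modulus_bounded u)) u0.
by apply/val_inj/funext => n; exact: u0.
Qed.

HB.instance Definition _ :=
  Lmodule_isNormed.Build F linfty linfty_normD linfty_normZ linfty_norm_eq0.

End linfty.

Section properties.
Context {R : realType} {s : scalars}.
Local Notation F := (scalar_field R s).
Implicit Types (X Z : normedModType F) (K : compactHausdorffType).

(* "[Z] contains C(K) isometrically as a closed subspace" is rendered by the
   linear embedding [J] of C(K) into [Z]. *)
Definition isometric_closed_embedding K Z (J : {linear cspace R s K -> Z}) :=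
  (forall a, `|J a| = `|a|) /\ closed (range J).

(* The pair (K, Z), C(K) being seen in [Z] through [J]. *)
Definition continuous_extension_property K Z (J : {linear cspace R s K -> Z}) :=
  exists rho : K -> dual Z,
    continuous (rho : K -> weak_star Z) /\
    forall t, (forall a, rho t (J a) = dirac_functional t a) /\ `|rho t| = 1.

Definition complemented_in_bidual X :=
  exists P : {linear dual (dual X) -> dual (dual X)},
    [/\ continuous P, (forall f, P (P f) = P f) &
        range P = range (@canonical_embedding R s X)].

Definition grothendieck_property X :=
  forall (u : nat -> dual X) (f : dual X),
    (u : nat -> weak_star X) @ \oo --> (f : weak_star X) ->
    (u : nat -> weak (dual X)) @ \oo --> (f : weak (dual X)).

(* [S] is the inverse of the homeomorphism [T] onto its range. *)
Definition contains_copy_of_linfty X :=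
  exists (T : {linear linfty R s -> X}) (S : X -> linfty R s),
    [/\ continuous T, closed (range T), cancel T S &
        {within range T, continuous S}].

End properties.

(* Main.v *)
(* The maps [rho t] assemble into a contractive projection of [Y^*] onto C(K).
   Since a functional on [C(K)^*] induces one on [Y] through
   [y |-> (a |-> J a y)], hence an element of [Y^*], this projection yields a
   contractive left inverse [Q : C(K)^** -> C(K)] of the canonical embedding.

   A weakly unconditionally Cauchy series [\sum c_k] in C(K) defines an operator
   from [linfty] to [C(K)^**], and [Q] brings it back to C(K): one gets
   [S : linfty -> C(K)] with [S e_k = c_k].

   If the [c_k] are disjoint bumps, Rosenthal's lemma gives an infinite set of
   indices on which [S] is bounded below, that is a copy of [linfty].

   For the Grothendieck property, let [f_n -> 0] be weak-star null. By Phillips'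
   lemma applied to the functionals [f_n \o S], [f_n c_k -> 0] uniformly in [n]
   for each such series. Hence the variations of the [f_n] are uniformly
   countably additive along bounded monotone sequences of C(K), and therefore
   uniformly absolutely continuous. Given [phi] in the bidual, a Hilbert space
   argument in [L^2(|f_0| + ... + |f_j|)] produces a bounded sequence [a_j] in
   C(K) that is Cauchy in [L^2(|f_n|)] and satisfies [f_n a_j -> phi f_n], for
   each [n]. By uniform absolute continuity [f_n a_j -> phi f_n] uniformly in
   [n], so [phi f_n -> 0]. This is done over the reals; the complex case follows
   by taking real and imaginary parts. *)

Require Import Defs.
From HB Require Import structures.
From mathcomp Require Import all_boot all_order all_algebra.
From mathcomp Require Import all_classical all_reals all_analysis.
From mathcomp Require Import ring lra complex.

Set Implicit Arguments.
Unset Strict Implicit.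
Unset Printing Implicit Defensive.

Import Order.TTheory GRing.Theory Num.Theory.
Import numFieldNormedType.Exports.

Local Open Scope classical_set_scope.
Local Open Scope ring_scope.

(** * Rosenthal's lemma *)

(** Functionals are bare functions constrained only on [A], so that the same lemmas serve bounded
    sequences and real continuous functions without a bundled type. *)
Definition linear_on (T : Type) (F : numFieldType) (A : set (T -> F))
    (f : (T -> F) -> F) :=
  forall a u v, A u -> A v -> f (fun t => a * u t + v t) = a * f u + f v.

Definition bounded_seq (F : numFieldType) : set (nat -> F) :=
  [set u | exists2 M, 0 <= M & forall n, `|u n| <= M].

(** * Extension by zero along an injection of the indices *)

Section spread.
Context {F : numFieldType}.
Implicit Types (m : nat -> nat) (u v : nat -> F).

(** A preimage is picked by choice, so this is the pushforward of [u] only for injective [m]. *)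
Definition spread m u : nat -> F := fun i =>
  if pselect (exists k, m k = i) is left h then u (projT1 (cid h)) else 0.

Lemma spreadE m u k : injective m -> spread m u (m k) = u k.
Proof.
move=> minj; rewrite /spread; case: pselect => [h|[]]; last by exists k.
by rewrite (minj _ _ (projT2 (cid h))).
Qed.

Lemma spread_out m u i : (forall k, m k <> i) -> spread m u i = 0.
Proof.
by move=> mi; rewrite /spread; case: pselect => // h;
case: (mi _ (projT2 (cid h))).
Qed.

Variant spread_spec m u i : F -> Prop :=
  | SpreadIn k of m k = i : spread_spec m u i (u k)
  | SpreadOut of (forall k, m k <> i) : spread_spec m u i 0.

Lemma spreadP m u i : spread_spec m u i (spread m u i).
Proof.
rewrite /spread; case: pselect => [h|h].
  by constructor; exact: projT2 (cid h).
by constructor => k km; apply: h; exists k.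
Qed.

Lemma spread_le m u (M : F) : 0 <= M -> (forall k, `|u k| <= M) ->
  forall i, `|spread m u i| <= M.
Proof. by move=> M0 uM i; case: spreadP => // _; rewrite normr0. Qed.

Lemma spread_linear m a u v :
  spread m (fun i => a * u i + v i) = fun i => a * spread m u i + spread m v i.
Proof.
by apply/funext => i; rewrite /spread; case: pselect => // _; rewrite mulr0 addr0.
Qed.

Lemma spread_comp m m' u : injective m -> injective m' ->
  spread m (spread m' u) = spread (m \o m') u.
Proof.
move=> minj m'inj; apply/funext => i; case: (spreadP m) => [k <-{i}|mi].
  case: (spreadP m') => [l <-|m'k].
    by rewrite (@spreadE (m \o m'))//; exact: inj_comp.
  by rewrite spread_out//= => l /minj; exact: m'k.
by rewrite spread_out//= => l; exact: mi.
Qed.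

Lemma bounded_spread m u : bounded_seq u -> bounded_seq (spread m u).
Proof. by move=> [M M0 uM]; exists M => //; exact: spread_le. Qed.

Lemma bounded_seqZD a u v :
  bounded_seq u -> bounded_seq v -> bounded_seq (fun i => a * u i + v i).
Proof.
move=> [M M0 uM] [N N0 vN]; exists (`|a| * M + N) => [|n].
  by rewrite addr_ge0// mulr_ge0.
by rewrite (le_trans (ler_normD _ _))// lerD// normrM ler_wpM2l.
Qed.

End spread.

Lemma linear_on0 (T : Type) (F : numFieldType) (A : set (T -> F)) f :
  A (fun _ => 0) -> linear_on A f -> f (fun _ => 0) = 0.
Proof.
move=> A0 lf; have := lf (-1) _ _ A0 A0.
rewrite (_ : (fun _ => _) = fun=> 0); last by apply/funext => t; rewrite mulr0 addr0.
by move=> ->; rewrite mulN1r addNr.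
Qed.

Lemma phaseP (F : numFieldType) (z : F) : exists2 w, `|w| <= 1 & w * z = `|z|.
Proof.
have [->|z0] := eqVneq z 0; first by exists 0; rewrite ?normr0 ?mulr0.
exists (`|z| / z); last by rewrite divfK.
by rewrite normrM normr_id normfV divff// normr_eq0.
Qed.

(* Kupka's proof: split the indices into infinitely many infinite blocks. If no
   block works, picking a bad index in each block yields a sequence along which
   the variation of the functionals has dropped by [eps]. *)
Lemma rosenthal (F : numFieldType) (eps : F) (N : nat) : 0 < eps ->
  forall mu : nat -> (nat -> F) -> F,
  (forall n, linear_on (@bounded_seq F) (mu n)) ->
  (forall n u, (forall k, `|u k| <= 1) -> `|mu n u| <= N%:R * eps) ->
  exists2 m : nat -> nat, injective m &
    forall k u, (forall i, `|u i| <= 1) -> u k = 0 ->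
      `|mu (m k) (spread m u)| <= eps.
Proof.
move=> e0; elim: N => [|N IH] mu lmu bmu.
  exists id => // k u u1 _; rewrite (le_trans (bmu _ _ _)) ?mul0r ?ltW//.
  exact: spread_le.
(* The [j]-th block of indices is the range of [p j]; [pickle] makes the blocks disjoint. *)
pose p (j k : nat) : nat := pickle (j, k).
have pinj j k j' k' : p j k = p j' k' -> j = j' /\ k = k'.
  by move=> /(pcan_inj pickleK)[-> ->].
have [[j jgood]|bad] := pselect (exists j, forall k u, (forall i, `|u i| <= 1) ->
    u k = 0 -> `|mu (p j k) (spread (p j) u)| <= eps).
  by exists (p j) => // k k' /pinj[].
have {bad} /choice[q qP] j : exists q : nat * (nat -> F),
    [/\ forall i, `|q.2 i| <= 1, q.2 q.1 = 0 &
    eps < `|mu (p j q.1) (spread (p j) q.2)|].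
  apply: contrapT => h; apply: bad; exists j => k u u1 uk.
  rewrite real_leNgt ?normr_real ?gtr0_real//; apply/negP => lt.
  by apply: h; exists (k, u).
pose m j := p j (q j).1.
have minj : injective m by move=> j j' /pinj[].
have bdd1 (u : nat -> F) : (forall i, `|u i| <= 1) -> bounded_seq u by exists 1.
have [] := IH (fun j w => mu (m j) (spread m w)).
- move=> n a u v bu bv; rewrite spread_linear lmu//; exact: bounded_spread.
- move=> j w w1; have [v1 vq vmu] := qP j.
  set z := spread m w; set v := spread (p j) (q j).2 in vmu.
  have z1 : forall i, `|z i| <= 1 by exact: spread_le.
  have v1' : forall i, `|v i| <= 1 by exact: spread_le.
  have [a a1 az] := phaseP (mu (m j) z); have [b b1 bv] := phaseP (mu (m j) v).
  (* [z] lives on the range of [m] and [v] on the [j]-th block; these meet only at [m j], where [v]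
     vanishes. Disjoint supports keep the combination in the unit ball, so the values at [z] and [v]
     share the bound [N.+1%:R * eps], of which [v] takes more than [eps]. *)
  have vz i : `|a * z i + b * v i| <= 1.
    have [zi0|zi0] := eqVneq (z i) 0.
      by rewrite zi0 mulr0 add0r normrM mulr_ile1.
    have [vi0|vi0] := eqVneq (v i) 0.
      by rewrite vi0 mulr0 addr0 normrM mulr_ile1.
    exfalso; move: zi0 vi0; rewrite /z /v.
    case: spreadP => [k <-{i} _|]; last by rewrite eqxx.
    case: spreadP => [l /pinj[<- ->]|]; last by rewrite eqxx.
    by rewrite vq eqxx.
  have bz0 : bounded_seq (fun=> 0 : F) by apply: bdd1 => i; rewrite normr0.
  have bv1 : bounded_seq (fun i => b * v i).
    by apply: bdd1 => i; rewrite normrM mulr_ile1.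
  have := bmu (m j) _ vz; rewrite lmu//; last exact: bdd1.
  have -> : mu (m j) (fun i => b * v i) = b * mu (m j) v.
    have := lmu (m j) b v _ (bdd1 _ v1') bz0.
    rewrite (linear_on0 bz0 (lmu _)) addr0 => <-; congr (mu (m j) _).
    by apply/funext => i; rewrite addr0.
  rewrite az bv ger0_norm ?addr_ge0// -natr1 mulrDl mul1r => le1.
  rewrite -(lerD2r eps); apply: le_trans le1.
  by rewrite lerD2l ltW.
move=> m' m'inj m'P; exists (m \o m'); first exact: inj_comp.
by move=> k u u1 uk; have := m'P k u u1 uk; rewrite spread_comp.
Qed.

(** * Uniform boundedness and Phillips' lemma *)

Section uniform_boundedness.
Context {R : realType}.

Definition norm_bound (T : Type) (A : set (T -> R)) (f : (T -> R) -> R) (C : R) :=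
  forall u M, 0 <= M -> A u -> (forall t, `|u t| <= M) -> `|f u| <= C * M.

Lemma linear_onD (T : Type) (A : set (T -> R)) f u v : linear_on A f ->
  A u -> A v -> f (fun t => u t + v t) = f u + f v.
Proof.
move=> lf Au Av; rewrite -[in RHS](mul1r (f u)) -lf//.
by congr f; apply/funext => t; rewrite mul1r.
Qed.

Lemma linear_onZ (T : Type) (A : set (T -> R)) f a u : linear_on A f ->
  A (fun=> 0) -> A u -> f (fun t => a * u t) = a * f u.
Proof.
move=> lf A0 Au; rewrite -[RHS]addr0 -(linear_on0 A0 lf) -lf//.
by congr f; apply/funext => t; rewrite addr0.
Qed.

Lemma linear_onB (T : Type) (A : set (T -> R)) f u v : linear_on A f ->
  A u -> A v -> f (fun t => u t - v t) = f u - f v.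
Proof.
move=> lf Au Av; rewrite [RHS]addrC -mulN1r -lf//.
by congr f; apply/funext => t; rewrite mulN1r addrC.
Qed.

Lemma bounded_seq0 : bounded_seq (fun=> 0 : R).
Proof. by exists 0 => // n; rewrite normr0. Qed.

(** The interval around [x k] has radius [3 / 2 * 3^-1 ^+ k], the sum of all steps from [k] on.
    These intervals are nested, and the supremum of their left ends lies in each. *)
Lemma nested_limit (x : nat -> R) :
  (forall k, `|x k.+1 - x k| <= 3^-1 ^+ k) ->
  exists l, forall k, `|l - x k| <= 3 / 2 * 3^-1 ^+ k.
Proof.
move=> xk; set e := fun k : nat => 3 / 2 * 3^-1 ^+ k : R.
have eS k : e k.+1 = e k - 3^-1 ^+ k by rewrite /e exprS; field.
have e0 k : 0 <= e k by rewrite mulr_ge0// exprn_ge0.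
have inc k d : x k - e k <= x (k + d)%N - e (k + d)%N.
  elim: d => [|d IH]; first by rewrite addn0.
  apply: (le_trans IH); rewrite addnS eS.
  have := xk (k + d)%N; rewrite ler_norml => /andP[+ _]; lra.
have dec k d : x (k + d)%N + e (k + d)%N <= x k + e k.
  elim: d => [|d IH]; first by rewrite addn0.
  apply: le_trans IH; rewrite addnS eS.
  have := xk (k + d)%N; rewrite ler_norml => /andP[_ +]; lra.
have ub j k : x j - e j <= x k + e k.
  case: (leqP j k) => [jk|/ltnW kj].
    by have := inc j (k - j)%N; rewrite subnKC//; have := e0 k; lra.
  by have := dec k (j - k)%N; rewrite subnKC//; have := e0 j; lra.
set E := range (fun k => x k - e k).
have ubE : has_ubound E by exists (x 0%N + e 0%N) => _ [j _ <-].
exists (sup E) => k; rewrite -/(e k) ler_norml; apply/andP; split.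
  by rewrite lerBrDl; apply: ub_le_sup => //; exists k.
rewrite lerBlDl; apply: ge_sup; first by exists (x 0%N - e 0%N), 0%N.
by move=> _ [j _ <-].
Qed.

(** [S] is the norm of [nu] on the unit ball of [A], finite by [norm_bound]. The factor 3/4 has to
    beat the loss of 1/2 in [uniform_boundedness_seq]. *)
Lemma near_norming (T : Type) (A : set (T -> R)) (nu : (T -> R) -> R)
    (C c : R) (u : T -> R) :
  norm_bound A nu C -> 0 <= c -> A u -> (forall t, `|u t| <= 1) ->
  c < `|nu u| ->
  exists S v, [/\ c < S, A v, forall t, `|v t| <= 1, 3 / 4 * S <= `|nu v| &
    forall w, A w -> (forall t, `|w t| <= 1) -> `|nu w| <= S].
Proof.
move=> bnu c0 Au u1 cu.
set E := [set `|nu w| | w in [set w | A w /\ forall t, `|w t| <= 1]].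
have ubE : has_ubound E.
  by exists C => _ [w [Aw w1] <-]; have := bnu w 1 ler01 Aw w1; rewrite mulr1.
have uE : `|nu u| <= sup E by apply: ub_le_sup => //; exists u.
have E0 : 0 < sup E by lra.
have hs : has_sup E by split=> //; exists `|nu u|, u.
have S4 : 0 < sup E / 4 by lra.
have [_ [v [Av v1] <-] vS] := sup_adherent S4 hs.
exists (sup E), v; split=> //; [lra|lra|] => w Aw w1.
by apply: ub_le_sup => //; exists w.
Qed.

(* Sokal's elementary proof: the better of [x_k + 3^-k v_k] and [x_k - 3^-k v_k]
   makes the [k]-th functional large, and the remaining steps are too small to
   undo this. *)
Lemma uniform_boundedness_seq (nu : nat -> (nat -> R) -> R) :
  (forall n, linear_on (@bounded_seq R) (nu n)) ->
  (forall n, exists C, norm_bound (@bounded_seq R) (nu n) C) ->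
  (forall u, bounded_seq u -> exists M, forall n, `|nu n u| <= M) ->
  exists C, forall n u, (forall k, `|u k| <= 1) -> `|nu n u| <= C.
Proof.
move=> lnu bnu ptw; apply: contrapT => unb.
have bdd1 (u : nat -> R) : (forall i, `|u i| <= 1) -> bounded_seq u by exists 1.
(* [q k] holds a functional, its norm and a near-norming vector; a norm above [k%:R * 3 ^+ k] stays
   above [k%:R] after scaling by [3^-1 ^+ k]. *)
have /choice[q qP] k : exists q : nat * R * (nat -> R),
  [/\ k%:R * 3 ^+ k < q.1.2, forall i, `|q.2 i| <= 1,
    3 / 4 * q.1.2 <= `|nu q.1.1 q.2| &
    forall w, (forall i, `|w i| <= 1) -> `|nu q.1.1 w| <= q.1.2].
  apply: contrapT => h; apply: unb; exists (k%:R * 3 ^+ k) => n u u1.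
  rewrite leNgt; apply/negP => lt; apply: h; have [C bC] := bnu n.
  have c0 : 0 <= k%:R * 3 ^+ k :> R by rewrite mulr_ge0// exprn_ge0.
  have [S [v [h1 h2 h3 h4 h5]]] := near_norming bC c0 (bdd1 u u1) u1 lt.
  by exists (n, S, v); split=> // w w1; apply: h5 => //; exact: bdd1.
pose n_ k := (q k).1.1; pose S_ k := (q k).1.2.
pose v k := fun i => 3^-1 ^+ k * (q k).2 i.
pose step k x := if `|nu (n_ k) (v k)| <= `|nu (n_ k) (fun i => x i + v k i)|
  then (fun i => x i + v k i) else (fun i => x i - v k i).
pose xs := fix xs k := if k is k'.+1 then step k' (xs k') else fun=> 0 : R.
have t0 k : 0 < 3^-1 ^+ k :> R by rewrite exprn_gt0.
have vle k i : `|v k i| <= 3^-1 ^+ k.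
  rewrite /v normrM (gtr0_norm (t0 k)) ler_piMr ?(ltW (t0 k))//.
  by have [_ ->] := qP k.
have bv k : bounded_seq (v k) by exists (3^-1 ^+ k); rewrite ?ltW.
have xsS k i : `|xs k.+1 i - xs k i| <= 3^-1 ^+ k.
  rewrite /= /step; case: ifP => _.
    by rewrite [X in X - _]addrC addrK.
  by rewrite [X in X - _]addrC addrK normrN.
have bxs k : bounded_seq (xs k).
  elim: k => [|k [M M0 IH]] /=; first exact: bounded_seq0.
  exists (M + 3^-1 ^+ k) => [|i]; first by rewrite addr_ge0// ltW.
  have := xsS k i; have := IH i; rewrite !ler_norml /= => /andP[? ?] /andP[? ?].
  apply/andP; split; lra.
(* The values at the two candidates differ by twice the value at [v k], so one of them is at least
   as large in modulus as the latter. *)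
have big k : `|nu (n_ k) (v k)| <= `|nu (n_ k) (xs k.+1)|.
  rewrite /= /step; case: ifPn => //; rewrite -ltNge.
  rewrite (linear_onD (lnu _))// (linear_onB (lnu _))//.
  rewrite ltr_norml ler_normr => /andP[].
  by case: (ler0P (nu (n_ k) (v k))) => ? ? ?; apply/orP; [left|right]; lra.
have /choice[x xP] i := nested_limit (fun k => xsS k i).
have bx : bounded_seq x.
  have [M M0 xM] := bxs 0%N; exists (M + 3 / 2) => [|i]; first lra.
  have := xP i 0%N; have := xM i; rewrite expr0 mulr1 !ler_norml.
  move=> /andP[? ?] /andP[? ?]; apply/andP; split; lra.
have [M ptM] := ptw x bx.
(* In units of [3^-1 ^+ k * S_ k], which exceeds [k%:R], the [k]-th step gives at least 3/4 and the
   tail takes back at most 1/2. *)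
have key k : k%:R <= 4 * M.
  have [Sk u1 uS nS] := qP k; rewrite -/(n_ k) -/(S_ k) in Sk uS nS.
  have nuv : 3^-1 ^+ k * (3 / 4 * S_ k) <= `|nu (n_ k) (v k)|.
    rewrite /v (linear_onZ _ (lnu _))//; [|exact: bounded_seq0|by apply: bdd1].
    by rewrite normrM (gtr0_norm (t0 k)) ler_wpM2l// ltW.
  have nud : `|nu (n_ k) (fun i => x i - xs k.+1 i)| <= 2^-1 * 3^-1 ^+ k * S_ k.
    have c0 : 0 < 2^-1 * 3^-1 ^+ k :> R by rewrite mulr_gt0.
    set y := fun i => (2^-1 * 3^-1 ^+ k)^-1 * (x i - xs k.+1 i).
    have y1 i : `|y i| <= 1.
      rewrite /y normrM normfV (gtr0_norm c0) ler_pdivrMl// mulr1.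
      by apply: (le_trans (xP i k.+1)); rewrite exprS; lra.
    have -> : (fun i => x i - xs k.+1 i) = fun i => 2^-1 * 3^-1 ^+ k * y i.
      by apply/funext => i; rewrite /y mulVKf// gt_eqF.
    rewrite (linear_onZ _ (lnu _))//; [|exact: bounded_seq0|by apply: bdd1].
    by rewrite normrM (gtr0_norm c0) ler_pM2l// nS.
  rewrite (linear_onB (lnu _))// in nud.
  have xk : k%:R * 3 ^+ k * 3^-1 ^+ k = k%:R :> R.
    by rewrite -mulrA -exprMn divff// expr1n mulr1.
  have : 3^-1 ^+ k * (k%:R * 3 ^+ k) <= 3^-1 ^+ k * S_ k.
    by rewrite ler_pM2l// ltW.
  rewrite [X in X <= _]mulrC xk.
  have := big k; have := ptM (n_ k).
  have := lerB_dist (nu (n_ k) (xs k.+1)) (nu (n_ k) x); rewrite distrC.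
  lra.
have := key (Num.bound (4 * M)); rewrite leNgt => /negP; apply.
apply: le_lt_trans (archi_boundP _); rewrite ?ler_norm//.
have := key 0%N; lra.
Qed.

(* Phillips' lemma: on the indices given by [rosenthal], the [k]-th functional
   nearly agrees on the indicator of the range with its [k]-th coefficient. *)
Lemma phillips (nu : nat -> (nat -> R) -> R) (e : R) : 0 < e ->
  (forall n, linear_on (@bounded_seq R) (nu n)) ->
  (forall n, exists C, norm_bound (@bounded_seq R) (nu n) C) ->
  (forall u, bounded_seq u -> forall d, 0 < d ->
    exists N, forall n, (N <= n)%N -> `|nu n u| <= d) ->
  exists n, `|nu n (fun i => (i == n)%:R)| < e.
Proof.
move=> e0 lnu bnu nu0; apply: contrapT => h.
have big n : e <= `|nu n (fun i => (i == n)%:R)|.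
  by rewrite leNgt; apply/negP => ?; apply: h; exists n.
have bdd1 (u : nat -> R) : (forall i, `|u i| <= 1) -> bounded_seq u by exists 1.
have [|C CP] := uniform_boundedness_seq lnu bnu.
  move=> u bu; have [N NP] := nu0 u bu 1 ltr01.
  exists (1 + \sum_(n < N) `|nu n u|) => n.
  have [Nn|nN] := leqP N n.
    by rewrite (le_trans (NP n Nn))// lerDl sumr_ge0.
  rewrite (bigD1 (Ordinal nN))//= addrCA lerDl addr_ge0//.
  exact: sumr_ge0.
have e4 : 0 < e / 4 by lra.
have [|m minj mP] := rosenthal (eps := e / 4) (N := Num.bound (C / (e / 4))) e4 lnu.
  move=> n u u1; rewrite (le_trans (CP n u u1))// -ler_pdivrMr// ltW//.
  by rewrite archi_boundP// divr_ge0 ?(ltW e4)// (le_trans _ (CP n u u1)).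
set chi := spread m (fun=> 1 : R).
have [|N NP] := nu0 chi _ _ e4.
  by apply: bounded_spread; apply: bdd1 => i; rewrite normr1.
have [k Nk] : exists k, (N <= m k)%N.
  apply: contrapT => /forallNP small.
  have mN k : (m k < N)%N by rewrite ltnNge; apply/negP/small.
  pose f (k : 'I_N.+1) : 'I_N := Ordinal (mN k).
  have /leq_card : injective f by move=> i j [] /minj /val_inj.
  by rewrite !card_ord ltnn.
(* With this [u], [chi] is the [m k]-th unit vector plus [spread m u]; the values at [chi] and at
   [spread m u] are both at most [e / 4]. *)
set u := fun i => (i != k)%:R : R.
have u1 i : `|u i| <= 1 by rewrite /u; case: eqP => _; rewrite ?normr0 ?normr1.
have uk : u k = 0 by rewrite /u eqxx.
have small := mP k u u1 uk; have := NP _ Nk; have := big (m k).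
have -> : nu (m k) chi =
    nu (m k) (fun i => (i == m k)%:R) + nu (m k) (spread m u).
  rewrite -(linear_onD (lnu _))//; last first.
  - by apply: bounded_spread; exact: bdd1.
  - by apply: bdd1 => i; case: eqP => _; rewrite ?normr0 ?normr1.
  congr nu; apply/funext => i; rewrite /chi.
  case: (spreadP m) => [l <-{i}|mi].
    rewrite spreadE// /u; have [->|lk] := eqVneq l k; first by rewrite eqxx addr0.
    by rewrite (inj_eq minj) (negbTE lk) add0r.
  by rewrite spread_out// addr0; case: eqP => // /esym/mi.
have := lerB_dist (nu (m k) (fun i => (i == m k)%:R)) (- nu (m k) (spread m u)).
rewrite opprK normrN; lra.
Qed.

End uniform_boundedness.

(** * Positive forms on function algebras *)

(** What the measure-theoretic part uses of the real continuous functions on [K]: an algebra and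
    lattice of bounded functions with constants, on a set [T] without topology. *)
Record function_algebra (R : realType) (T : Type) (A : set (T -> R)) : Prop := {
  fa_cst : forall c, A (fun=> c);
  fa_add : forall a b, A a -> A b -> A (fun t => a t + b t);
  fa_mul : forall a b, A a -> A b -> A (fun t => a t * b t);
  fa_norm : forall a, A a -> A (fun t => `|a t|);
  fa_bdd : forall a, A a -> exists M, forall t, `|a t| <= M }.

Section function_algebra_theory.
Context {R : realType} {T : Type} {A : set (T -> R)} (hA : function_algebra A).

Lemma fa_opp a : A a -> A (fun t => - a t).
Proof.
move=> Aa; rewrite (_ : (fun _ => _) = fun t => (-1) * a t).
  by apply: fa_mul => //; exact: fa_cst.
by apply/funext => t; rewrite mulN1r.
Qed.

Lemma fa_max a b : A a -> A b -> A (fun t => Num.max (a t) (b t)).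
Proof.
move=> Aa Ab; rewrite (_ : (fun _ => _) =
    fun t => 2^-1 * (a t + b t + `|a t + - b t|)).
  apply: (fa_mul hA (fa_cst hA _)); apply: fa_add => //; first exact: fa_add.
  by apply: fa_norm => //; apply: fa_add => //; exact: fa_opp.
by apply/funext => t; rewrite maxr_absE mulrC.
Qed.

Lemma fa_min a b : A a -> A b -> A (fun t => Num.min (a t) (b t)).
Proof.
move=> Aa Ab; rewrite (_ : (fun _ => _) = fun t => - Num.max (- a t) (- b t)).
  by apply: fa_opp; apply: fa_max; exact: fa_opp.
by apply/funext => t; rewrite oppr_max !opprK.
Qed.

End function_algebra_theory.

Ltac fa := repeat first
  [ assumption
  | match goal with h : function_algebra _ |- _ =>
      first [ exact: (fa_cst h) | apply: (fa_add h) | apply: (fa_opp h)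
            | apply: (fa_mul h) | apply: (fa_norm h)
            | apply: (fa_max h) | apply: (fa_min h) ] end ].

(** A nonnegative quadratic in [s] has a nonpositive discriminant: evaluate at the vertex, or, if
    [q = 0], note that an affine function bounded below is constant. The constant [d] is either a
    squared norm or the slack of an approximate minimiser. *)
Lemma sqr_bound_discr (R : realType) (q b d : R) : 0 <= q -> 0 <= d ->
  (forall s, - d <= s ^+ 2 * q + 2 * s * b) -> b ^+ 2 <= d * q.
Proof.
move=> q0 d0 h; have [q00|qn0] := eqVneq q 0.
  have [->|b0] := eqVneq b 0; first by rewrite expr0n mulr_ge0.
  have := h (- (d + 1) / (2 * b)); rewrite q00 mulr0 add0r.
  have -> : 2 * (- (d + 1) / (2 * b)) * b = - (d + 1) by field.
  lra.
have qp : 0 < q by rewrite lt0r qn0.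
have := h (- b / q); have -> : (- b / q) ^+ 2 * q + 2 * (- b / q) * b = - (b ^+ 2 / q).
  by field.
by rewrite lerN2 ler_pdivrMr.
Qed.

Lemma sqr_le_norm (R : realType) (x y : R) : 0 <= y -> x ^+ 2 <= y ^+ 2 -> `|x| <= y.
Proof.
by move=> y0 xy; rewrite ler_norml; apply/andP; split; nra.
Qed.

(** Riesz decomposition by truncation, the source of the additivity of variations. *)
Lemma clamp_split (R : realType) (x a b : R) : 0 <= a -> 0 <= b ->
  `|x| <= a + b ->
  `|Num.max (- a) (Num.min x a)| <= a /\ `|x - Num.max (- a) (Num.min x a)| <= b.
Proof.
move=> a0 b0; rewrite !ler_norml => /andP[? ?].
case: (lerP x a) => ?.
  by case: (lerP (- a) x) => ?; split; apply/andP; split; lra.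
by case: (lerP (- a) a) => ?; split; apply/andP; split; lra.
Qed.

Section positive_form.
Context {R : realType} {T : Type} {A : set (T -> R)} (hA : function_algebra A).
Variable g : (T -> R) -> R.
Hypothesis lg : linear_on A g.
Hypothesis g0 : forall a, A a -> (forall t, 0 <= a t) -> 0 <= g a.
Let G := g (fun=> 1).

Let gD u v : A u -> A v -> g (fun t => u t + v t) = g u + g v.
Proof. exact: linear_onD. Qed.

Let gB u v : A u -> A v -> g (fun t => u t - v t) = g u - g v.
Proof. exact: linear_onB. Qed.

Let gZ a u : A u -> g (fun t => a * u t) = a * g u.
Proof. by move=> Au; rewrite (linear_onZ _ lg)//; exact: fa_cst hA 0. Qed.

Let gq u : A u -> 0 <= g (fun t => u t * u t).
Proof. by move=> Au; apply: g0 => [|t]; [fa|rewrite -expr2 sqr_ge0]. Qed.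

Let g_mono u v : A u -> A v -> (forall t, u t <= v t) -> g u <= g v.
Proof.
move=> Au Av uv; rewrite -subr_ge0 -gB//.
by apply: g0 => [|t]; [fa|rewrite subr_ge0].
Qed.

Let G0 : 0 <= G. Proof. by apply: g0 => //; exact: fa_cst hA 1. Qed.

Let g_quad u s v : A u -> A v ->
  g (fun t => (u t + s * v t) * (u t + s * v t)) =
  g (fun t => u t * u t) + 2 * s * g (fun t => u t * v t) +
  s ^+ 2 * g (fun t => v t * v t).
Proof.
move=> Au Av; rewrite -!gZ; try by fa.
rewrite -!gD; try by fa.
by congr g; apply/funext => t; ring.
Qed.

Lemma form_cauchy u v : A u -> A v ->
  g (fun t => u t * v t) ^+ 2 <= g (fun t => u t * u t) * g (fun t => v t * v t).
Proof.
move=> Au Av; apply: sqr_bound_discr; [exact: gq|exact: gq|] => s.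
have : A (fun t => u t + s * v t) by fa.
by move=> /gq; rewrite g_quad//; lra.
Qed.

Lemma form_sup_bound u (M : R) : A u -> (forall t, `|u t| <= M) ->
  g (fun t => u t * u t) <= M ^+ 2 * G.
Proof.
move=> Au uM; rewrite -gZ; last by fa.
apply: g_mono; [by fa|by fa|] => t; rewrite mulr1 -expr2 -real_normK ?num_real//.
by have := uM t; have := normr_ge0 (u t); nra.
Qed.

(* The quadratic functional [x |-> g (x x) - 2 l x] is bounded below; the lemma
   is the variational inequality at an approximate minimiser. *)
Lemma near_minimiser (B : set (T -> R)) l k d : B !=set0 -> B `<=` A ->
  (forall a b s, B a -> B b -> 0 <= s -> s <= 1 ->
    B (fun t => a t + s * (b t - a t))) ->
  linear_on A l ->
  (forall x, A x -> l x ^+ 2 <= k ^+ 2 * g (fun t => x t * x t)) -> 0 < d ->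
  exists2 a, B a & forall b s, B b -> 0 <= s -> s <= 1 ->
    - d <= s ^+ 2 * g (fun t => (b t - a t) * (b t - a t)) +
      2 * s * (g (fun t => a t * (b t - a t)) - l (fun t => b t - a t)).
Proof.
move=> [b0 Bb0] BA cB ll lk d0.
pose J x := g (fun t => x t * x t) - 2 * l x.
(* By the arithmetic-geometric mean inequality, [2 * l x <= q + k ^+ 2]. *)
have Jk x : A x -> - k ^+ 2 <= J x.
  move=> Ax; rewrite /J; set q := g _; have q0 : 0 <= q by exact: gq.
  have h : `|l x| <= (q + k ^+ 2) / 2.
    apply: sqr_le_norm; first by rewrite divr_ge0// addr_ge0// sqr_ge0.
    apply: (le_trans (lk x Ax)); rewrite -/q.
    by have := sqr_ge0 (q - k ^+ 2); lra.
  by have := ler_norm (l x); lra.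
have lbJ : has_inf [set J x | x in B].
  split; first by exists (J b0), b0.
  by exists (- k ^+ 2) => _ [x Bx <-]; exact/Jk/BA.
have [_ [a Ba <-] aJ] := inf_adherent d0 lbJ.
exists a => // b s Bb s0 s1.
have Jinf : inf [set J x | x in B] <= J (fun t => a t + s * (b t - a t)).
  by apply: ge_inf; [case: lbJ|exists (fun t => a t + s * (b t - a t)) => //; exact: cB].
have Aa := BA _ Ba; have Ab := BA _ Bb.
have Aba : A (fun t => b t - a t) by fa.
move: Jinf aJ; rewrite /J (g_quad s Aa Aba).
have -> : l (fun t => a t + s * (b t - a t)) = s * l (fun t => b t - a t) + l a.
  by rewrite -ll//; congr l; apply/funext => t; rewrite addrC.
lra.
Qed.

(** Riesz representation up to [d], as [A] need not be complete for [g]. The minimisation runs over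
    all of [A] with slack [d ^+ 2]; along the line through [a] in the direction [x],
    [sqr_bound_discr] turns the variational inequality into the estimate. *)
Lemma approx_riesz l k d : linear_on A l ->
  (forall x, A x -> l x ^+ 2 <= k ^+ 2 * g (fun t => x t * x t)) -> 0 < d ->
  exists2 a, A a & forall x, A x ->
    `|g (fun t => a t * x t) - l x| <= d * Num.sqrt (g (fun t => x t * x t)).
Proof.
move=> ll lk d0; have d2 : 0 < d ^+ 2 by rewrite exprn_gt0.
have [||a Aa aP] := near_minimiser _ (@subset_refl _ A) _ ll lk d2.
- by exists (fun=> 0); fa.
- by move=> a b s Aa Ab _ _; fa.
exists a => // x Ax; apply: sqr_le_norm; first by rewrite mulr_ge0 ?sqrtr_ge0 ?(ltW d0).
rewrite exprMn sqr_sqrtr ?gq//.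
apply: sqr_bound_discr; [exact: gq|exact: ltW|] => s.
have Aasx : A (fun t => a t + s * x t) by fa.
have := aP _ 1 Aasx ler01 (lexx 1).
have e t : a t + s * x t - a t = s * x t by rewrite addrAC subrr add0r.
under [fun t => (_ - _) * _]eq_fun do rewrite e.
under [fun t => a t * (_ - _)]eq_fun do rewrite e.
under [fun t => _ - _]eq_fun do rewrite e.
have -> : g (fun t => s * x t * (s * x t)) = s ^+ 2 * g (fun t => x t * x t).
  by rewrite -gZ; [congr g; apply/funext => t; ring|fa].
have -> : g (fun t => a t * (s * x t)) = s * g (fun t => a t * x t).
  by rewrite -gZ; [congr g; apply/funext => t; ring|fa].
by rewrite (linear_onZ _ ll)//; [lra|fa].
Qed.

End positive_form.

Definition bounded_functional (R : realType) (T : Type) (A : set (T -> R)) f :=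
  linear_on A f /\ exists2 C, 0 <= C & norm_bound A f C.

Definition positive_functional (R : realType) (T : Type) (A : set (T -> R)) g :=
  linear_on A g /\ forall a, A a -> (forall t, 0 <= a t) -> 0 <= g a.

(* A bounded linear form, of norm at most [M], on the functionals of [A], seen
   through their values on [A] only. *)
Definition bidual_form (R : realType) (T : Type) (A : set (T -> R))
    (M : R) (Phi : ((T -> R) -> R) -> R) :=
  [/\ forall c u v w, bounded_functional A u -> bounded_functional A v ->
        (forall a, A a -> w a = c * u a + v a) -> Phi w = c * Phi u + Phi v &
      forall u C, linear_on A u -> 0 <= C -> norm_bound A u C ->
        `|Phi u| <= M * C].

(** * Approximating a bidual form by points of a ball *)

Section bidual_approximation.
Context {R : realType} {T : Type} {A : set (T -> R)} (hA : function_algebra A).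
Variable g : (T -> R) -> R.
Hypothesis gpos : positive_functional A g.
Let lg := gpos.1.
Let g0 := gpos.2.
Let G := g (fun=> 1).
Let G0 : 0 <= G. Proof. by apply: g0 => //; exact: fa_cst hA 1. Qed.
Let nrm x := Num.sqrt (g (fun t => x t * x t)).
Let nrm0 x : 0 <= nrm x. Proof. exact: sqrtr_ge0. Qed.
Let gq u : A u -> 0 <= g (fun t => u t * u t).
Proof. by move=> Au; apply: g0 => [|t]; [fa|rewrite -expr2 sqr_ge0]. Qed.
Let nrm2 x : A x -> nrm x ^+ 2 = g (fun t => x t * x t).
Proof. by move=> Ax; rewrite sqr_sqrtr// gq. Qed.
Let gB u v : A u -> A v -> g (fun t => u t - v t) = g u - g v.
Proof. exact: linear_onB. Qed.
Let gZ a u : A u -> g (fun t => a * u t) = a * g u.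
Proof. by move=> Au; rewrite (linear_onZ _ lg)//; exact: fa_cst hA 0. Qed.

Let dot_le u v : A u -> A v -> `|g (fun t => u t * v t)| <= nrm u * nrm v.
Proof.
move=> Au Av; apply: sqr_le_norm; first by rewrite mulr_ge0.
by rewrite exprMn !nrm2// (form_cauchy hA lg g0).
Qed.

Let nrm_sup u M : 0 <= M -> A u -> (forall t, `|u t| <= M) ->
  nrm u <= M * Num.sqrt G.
Proof.
move=> M0 Au uM; apply: le_trans (ler_norm _) _; apply: sqr_le_norm.
  by rewrite mulr_ge0// sqrtr_ge0.
by rewrite exprMn nrm2// sqr_sqrtr// (form_sup_bound hA lg g0).
Qed.

Let form_norm_bound f c : 0 <= c -> (forall x, A x -> `|f x| <= c * nrm x) ->
  norm_bound A f (c * Num.sqrt G).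
Proof.
move=> c0 fc x m m0 Ax xm; apply: (le_trans (fc x Ax)).
by rewrite -mulrA ler_wpM2l// mulrC nrm_sup.
Qed.

Let riesz b x := g (fun t => b t * x t).

Let riesz_linear b : A b -> linear_on A (riesz b).
Proof.
move=> Ab c u v Au Av; rewrite /riesz -lg; try by fa.
by congr g; apply/funext => t; ring.
Qed.

Let riesz_bounded b : A b -> bounded_functional A (riesz b).
Proof.
move=> Ab; split; first exact: riesz_linear.
exists (nrm b * Num.sqrt G); first by rewrite mulr_ge0// sqrtr_ge0.
by apply: form_norm_bound => // x Ax; exact: dot_le.
Qed.

Variables (M : R) (Phi : ((T -> R) -> R) -> R).
Hypothesis (M0 : 0 < M) (hPhi : bidual_form A M Phi).

Let Phi_riesz_linear : linear_on A (fun b => Phi (riesz b)).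
Proof.
have [lPhi _] := hPhi; move=> c u v Au Av.
apply: lPhi; [exact: riesz_bounded|exact: riesz_bounded|] => x Ax.
rewrite /riesz -lg; try by fa.
by congr g; apply/funext => t; ring.
Qed.

Let Phi_riesz_le b : A b -> Phi (riesz b) ^+ 2 <=
  (M * Num.sqrt G) ^+ 2 * g (fun t => b t * b t).
Proof.
move=> Ab; have [_ bPhi] := hPhi.
have nb : norm_bound A (riesz b) (nrm b * Num.sqrt G).
  by apply: form_norm_bound => // x Ax; exact: dot_le.
have /bPhi := riesz_linear Ab.
move=> /(_ _ _ nb); rewrite mulr_ge0 ?sqrtr_ge0// => /(_ isT).
move=> h; rewrite -nrm2// -exprMn -[X in X <= _]real_normK ?num_real//.
rewrite ler_pXn2r// ?nnegrE ?mulr_ge0 ?sqrtr_ge0 ?(ltW M0)//.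
by rewrite -mulrA [Num.sqrt G * _]mulrC.
Qed.

(* On the forms [riesz b], [Phi] is given by a vector [a0] of the pre-Hilbert
   space [(A, g)]. Replacing [a0] by the nearest point [a] of the ball of radius
   [M] costs nothing, as otherwise [riesz (a0 - a)] would separate [Phi] from
   this ball. *)
Lemma bidual_approximation e : 0 < e -> exists2 a, A a /\ (forall t, `|a t| <= M) &
  forall f c, 0 < c -> linear_on A f ->
    (forall x, A x -> f x ^+ 2 <= c ^+ 2 * g (fun t => x t * x t)) ->
    `|Phi f - f a| <= e * c.
Proof.
move=> e0; have [lPhi bPhi] := hPhi.
pose s := Num.sqrt G; have s0 : 0 <= s by exact: sqrtr_ge0.
pose d := e / 4; have d0 : 0 < d by rewrite divr_gt0.
have [a0 Aa0 a0P] := approx_riesz hA lg g0 Phi_riesz_linear Phi_riesz_le d0.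
pose B := [set b | A b /\ forall t, `|b t| <= M].
have [k0 kk] : 0 < 1 + 4 * M ^+ 2 * G /\ 0 <= 4 * M ^+ 2 * G.
  have : 0 <= 4 * M ^+ 2 * G.
    by apply: mulr_ge0 => //; apply: mulr_ge0 => //; exact: sqr_ge0.
  by split=> //; lra.
(* Points of the ball differ by at most [2 * M], so [4 * M ^+ 2 * G] bounds the quadratic term. A
   step [tau] this short, with slack [tau ^+ 2], leaves an error of [d ^+ 2] after division by
   [2 * tau]. *)
pose tau := Num.min 1 (2 * d ^+ 2 / (1 + 4 * M ^+ 2 * G)).
have tau0 : 0 < tau by rewrite lt_min ltr01 divr_gt0// mulr_gt0// exprn_gt0.
have tau1 : tau <= 1 by rewrite ge_min lexx.
have tauk : tau * (1 + 4 * M ^+ 2 * G) <= 2 * d ^+ 2.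
  by rewrite -ler_pdivlMr// ge_min lexx orbT.
have B0 : B !=set0 by exists (fun=> 0); split=> [|t]; [fa|rewrite normr0 ltW].
have BA : B `<=` A by move=> b [].
have cB : forall a b r, B a -> B b -> 0 <= r -> r <= 1 ->
    B (fun t => a t + r * (b t - a t)).
  move=> a b r [Aa aM] [Ab bM] r0 r1; split; first by fa.
  move=> t; have := aM t; have := bM t; rewrite !ler_norml => /andP[? ?] /andP[? ?].
  apply/andP; split; nra.
have a0le x : A x -> riesz a0 x ^+ 2 <= nrm a0 ^+ 2 * g (fun t => x t * x t).
  by move=> Ax; rewrite nrm2// (form_cauchy hA lg g0).
have tau2 : 0 < tau ^+ 2 by rewrite exprn_gt0.
have [a [Aa aM] aP] :=
  near_minimiser hA lg g0 B0 BA cB (riesz_linear Aa0) a0le tau2.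
pose y t := a0 t - a t; have Ay : A y by rewrite /y; fa.
(* Up to [d ^+ 2], [y] is an outer normal to the ball [B] at [a]. *)
have yB b : B b -> g (fun t => y t * b t) <= g (fun t => y t * a t) + d ^+ 2.
  move=> [Ab bM]; have := aP b tau (conj Ab bM) (ltW tau0) tau1.
  have Aba : A (fun t => b t - a t) by fa.
  have bound : g (fun t => (b t - a t) * (b t - a t)) <= 4 * M ^+ 2 * G.
    rewrite (_ : 4 * M ^+ 2 = (2 * M) ^+ 2); last by ring.
    apply: (form_sup_bound hA lg g0) => // t; have := aM t; have := bM t.
    rewrite !ler_norml => /andP[? ?] /andP[? ?]; apply/andP; split; lra.
  have -> : riesz a0 (fun t => b t - a t) = g (fun t => y t * b t) -
      g (fun t => y t * a t) + g (fun t => a t * (b t - a t)).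
    rewrite -gB; try by fa.
    rewrite -(linear_onD lg); try by fa.
    by congr g; apply/funext => t; rewrite /y; ring.
  set P := g (fun t => y t * b t); set Q := g (fun t => y t * a t).
  set Z := g (fun t => a t * _); set W := g _ in bound *.
  move=> h; have h' : tau * (2 * (P - Q)) <= tau * (2 * d ^+ 2).
    have : tau * (2 * (P - Q)) <= tau ^+ 2 * (1 + W) by lra.
    move=> h1; apply: (le_trans h1); rewrite expr2 -mulrA ler_pM2l//.
    apply: le_trans tauk; rewrite ler_pM2l//; lra.
  by move: h'; rewrite ler_pM2l//; lra.
(* As [B] is the ball of radius [M], dividing the bound on [B] by [M] bounds the norm of
   [riesz y]. *)
pose C0 := (g (fun t => y t * a t) + d ^+ 2) / M.
have C00 : 0 <= C0.
  rewrite divr_ge0// ?(ltW M0)//.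
  have Bz : B (fun=> 0) by split=> [|t]; [fa|rewrite normr0 ltW].
  have := yB _ Bz; under eq_fun do rewrite mulr0.
  by rewrite (linear_on0 (fa_cst hA 0) lg).
have Cnb : norm_bound A (riesz y) C0.
  move=> x m m0 Ax xm; have [m00|mn0] := eqVneq m 0.
    have -> : x = fun=> 0.
      by apply/funext => t; apply/normr0_eq0/le_anti; rewrite normr_ge0 -m00 xm.
    rewrite /riesz; under eq_fun do rewrite mulr0.
    by rewrite (linear_on0 (fa_cst hA 0) lg) normr0 m00 mulr0.
  have mp : 0 < m by rewrite lt0r mn0.
  have h r : `|r| <= M / m -> r * riesz y x <= M * C0.
    move=> rM; have Bx : B (fun t => r * x t).
      split=> [|t]; first by fa.
      rewrite normrM -(divfK mn0 M) ler_pM//.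
    have -> : r * riesz y x = g (fun t => y t * (r * x t)).
      rewrite /riesz -gZ; last by fa.
      by congr g; apply/funext => t; ring.
    by have := yB _ Bx; rewrite /C0 [M * _]mulrC divfK ?gt_eqF.
  have Mm : 0 <= M / m by rewrite divr_ge0// ltW.
  have h1 : M / m * riesz y x <= M * C0 by apply: h; rewrite ger0_norm.
  have h2 : - (M / m) * riesz y x <= M * C0 by apply: h; rewrite normrN ger0_norm.
  have e1 : M * (riesz y x / m) <= M * C0 by rewrite mulrA mulrAC.
  have e2 : M * (- riesz y x / m) <= M * C0.
    by rewrite mulrA mulrAC mulrN -mulNr.
  move: e1 e2; rewrite !ler_pM2l// !ler_pdivrMr// => ? ?.
  by rewrite ler_norml; apply/andP; split; lra.
(* [Phi (riesz y)] is at most [M * C0] and within [d * nrm y] of the pairing of [a0] with [y];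
   subtracting the pairing of [a] with [y] gives [nrm y ^+ 2 <= d ^+ 2 + d * nrm y]. *)
have ry : nrm y <= 2 * d.
  have h1 := bPhi _ _ (riesz_linear Ay) C00 Cnb.
  have h2 := a0P _ Ay; rewrite -/(nrm y) in h2.
  have h3 : nrm y ^+ 2 = g (fun t => a0 t * y t) - g (fun t => y t * a t).
    rewrite nrm2// -gB; try by fa.
    by congr g; apply/funext => t; rewrite /y; ring.
  move: h1; rewrite /C0 [M * _]mulrC divfK ?gt_eqF// ler_norml => /andP[_ h1].
  move: h2; rewrite ler_norml => /andP[_ h2].
  have : nrm y ^+ 2 <= d ^+ 2 + d * nrm y by lra.
  by have := nrm0 y; nra.
exists a => // f c c0 lf fc.
pose k := 2 * M * s + e.
have kp : 0 < k by rewrite /k ltr_wpDl// !mulr_ge0// ltW.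
(* The term [3 * d * c] uses three quarters of [e * c]; [d'] keeps all other errors within the last
   quarter. *)
pose d' := e * c / (4 * k); have d'0 : 0 < d' by rewrite divr_gt0 ?mulr_gt0.
have dk : 4 * (d' * k) = e * c by rewrite /d'; field; rewrite gt_eqF.
have [b Ab bP] := approx_riesz hA lg g0 lf fc d'0.
have fb : bounded_functional A f.
  split=> //; exists (c * s); first by rewrite mulr_ge0// ltW.
  apply: form_norm_bound => [|x Ax]; first exact: ltW.
  apply: sqr_le_norm; first by rewrite mulr_ge0// ltW.
  by rewrite exprMn nrm2// fc.
pose h := fun x => (-1) * riesz b x + f x.
have lh : linear_on A h.
  move=> r u v Au Av; rewrite /h lf// (riesz_linear Ab)//; ring.
have hb : norm_bound A h (d' * s).
  apply: form_norm_bound => [|x Ax]; first exact: ltW.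
  by rewrite /h mulN1r -normrN opprD opprK bP.
have E1 : `|Phi f - Phi (riesz b)| <= M * (d' * s).
  have <- : Phi h = Phi f - Phi (riesz b).
    by rewrite (lPhi (-1) (riesz b) f) ?mulN1r 1?addrC//; exact: riesz_bounded.
  by apply: bPhi => //; rewrite mulr_ge0// ltW.
have rb : nrm b <= c + d'.
  have h1 : `|f b| <= c * nrm b.
    apply: sqr_le_norm; first by rewrite mulr_ge0// ltW.
    by rewrite exprMn nrm2// fc.
  have := bP _ Ab; rewrite -/(nrm b) -nrm2// => h2.
  have : nrm b ^+ 2 <= (c + d') * nrm b.
    move: h1 h2; rewrite !ler_norml => /andP[_ h1] /andP[_ h2]; lra.
  have [->|bn0] := eqVneq (nrm b) 0; first by rewrite addr_ge0// ltW.
  by rewrite expr2 ler_pM2r// lt0r bn0/=.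
have E2 : `|Phi (riesz b) - g (fun t => a0 t * b t)| <= d * (c + d').
  by rewrite distrC; apply: (le_trans (a0P _ Ab)); rewrite ler_wpM2l// ltW.
have E3 : `|g (fun t => a0 t * b t) - g (fun t => a t * b t)| <= 2 * d * (c + d').
  rewrite -gB; try by fa.
  rewrite (_ : (fun _ => _) = fun t => y t * b t); last first.
    by apply/funext => t; rewrite /y; ring.
  by apply: (le_trans (dot_le Ay Ab)); apply: ler_pM.
have E4 : `|g (fun t => a t * b t) - f a| <= d' * (M * s).
  have := bP _ Aa; rewrite (_ : (fun t => b t * a t) = fun t => a t * b t); last first.
    by apply/funext => t; rewrite mulrC.
  move=> /le_trans; apply; rewrite ler_wpM2l ?(ltW d'0)//.
  by apply: nrm_sup => //; exact: ltW.
have tot : 2 * M * s * d' + 3 * d * (c + d') <= e * c.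
  have : d' * k * 4 = 4 * (2 * M * s * d') + 4 * e * d' by rewrite /k; ring.
  have : 0 < e * d' by rewrite mulr_gt0.
  have : 0 <= 2 * M * s * d' by apply: mulr_ge0 (ltW d'0); rewrite !mulr_ge0// ltW.
  rewrite /d; lra.
apply: le_trans tot.
have -> : Phi f - f a = (Phi f - Phi (riesz b)) +
  ((Phi (riesz b) - g (fun t => a0 t * b t)) +
  ((g (fun t => a0 t * b t) - g (fun t => a t * b t)) +
   (g (fun t => a t * b t) - f a))) by ring.
apply: (le_trans (ler_normD _ _)); apply: (@le_trans _ _
  (M * (d' * s) + (d * (c + d') + (2 * d * (c + d') + d' * (M * s))))); last by lra.
apply: lerD => //; apply: (le_trans (ler_normD _ _)); apply: lerD => //.
by apply: (le_trans (ler_normD _ _)); apply: lerD.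
Qed.

End bidual_approximation.

(** * The variation of a bounded functional *)

Section variation.
Context {R : realType} {T : Type} {A : set (T -> R)} (hA : function_algebra A).
Variable f : (T -> R) -> R.
Hypothesis hf : bounded_functional A f.
Let lf := hf.1.

Let fZ c x : A x -> f (fun t => c * x t) = c * f x.
Proof. by move=> Ax; rewrite (linear_onZ _ lf)//; exact: fa_cst hA 0. Qed.

(** On nonnegative [a] this is the total variation of [f]; the test set is symmetric, so [f x] needs
    no absolute value. *)
Let V a := sup [set f x | x in [set x | A x /\ forall t, `|x t| <= a t]].

Let f_le_V x a : A x -> A a -> (forall t, `|x t| <= a t) -> f x <= V a.
Proof.
move=> Ax Aa xa; have [_ [C C0 fC]] := hf; have [N aN] := fa_bdd hA Aa.
apply: ub_le_sup; last by exists x.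
exists (C * `|N|) => _ [z [Az za] <-]; apply: le_trans (ler_norm _) _.
apply: fC => // t; apply: (le_trans (za t)); apply: le_trans (ler_norm _) _.
exact: le_trans (aN t) (ler_norm _).
Qed.

Let V_le a (c : R) : (forall t, 0 <= a t) ->
  (forall x, A x -> (forall t, `|x t| <= a t) -> f x <= c) -> V a <= c.
Proof.
move=> a0 h; apply: ge_sup => [|_ [x [Ax xa] <-]]; last exact: h.
exists (f (fun=> 0)), (fun=> 0) => //.
by split=> [|t]; [fa|rewrite normr0].
Qed.

(** Truncation splits a test function for the sum into test functions for [a] and [b]; conversely,
    test functions add up. *)
Let VD a b : A a -> A b -> (forall t, 0 <= a t) -> (forall t, 0 <= b t) ->
  V (fun t => a t + b t) = V a + V b.
Proof.
move=> Aa Ab a0 b0; apply/le_anti/andP; split.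
  apply: V_le => [t|x Ax xab]; first by rewrite addr_ge0.
  pose y t := Num.max (- a t) (Num.min (x t) (a t)).
  have Ay : A y by rewrite /y; fa.
  have -> : x = fun t => y t + (x t - y t) by apply/funext => t; rewrite addrC subrK.
  rewrite (linear_onD lf)//; last by fa.
  have bnd t : `|y t| <= a t /\ `|x t - y t| <= b t.
    exact: clamp_split.
  by apply: lerD; apply: f_le_V => //; [move=> t; case: (bnd t)|fa|
    move=> t; case: (bnd t)].
rewrite -lerBrDr; apply: V_le => // x Ax xa.
rewrite lerBrDr addrC -lerBrDr; apply: V_le => // y Ay yb.
rewrite lerBrDr -(linear_onD lf)//; apply: f_le_V; [by fa|by fa|] => t.
by rewrite (le_trans (ler_normD _ _))// addrC lerD.
Qed.

Let VZ_le c a : 0 < c -> A a -> (forall t, 0 <= a t) ->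
  c * V a <= V (fun t => c * a t).
Proof.
move=> c0 Aa a0; rewrite -ler_pdivlMl//; apply: V_le => // x Ax xa.
rewrite ler_pdivlMl// -fZ//.
by apply: f_le_V => [||t]; [fa|fa|rewrite normrM gtr0_norm// ler_pM2l].
Qed.

Let VZ c a : 0 <= c -> A a -> (forall t, 0 <= a t) ->
  V (fun t => c * a t) = c * V a.
Proof.
move=> c0 Aa a0; have [->|cn0] := eqVneq c 0.
  have Az : A (fun=> 0) by fa.
  rewrite mul0r; under eq_fun do rewrite mul0r.
  have := VD Az Az (fun=> lexx 0) (fun=> lexx 0).
  by under eq_fun do rewrite addr0; move=> h; lra.
have cp : 0 < c by rewrite lt0r cn0.
apply/le_anti/andP; split; last exact: VZ_le.
have ca0 t : 0 <= c * a t by rewrite mulr_ge0.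
have Aca : A (fun t => c * a t) by fa.
have ci : 0 < c^-1 by rewrite invr_gt0.
have := VZ_le ci Aca ca0; rewrite ler_pdivrMl//.
rewrite (_ : (fun t => c^-1 * _) = a)//.
by apply/funext => t; rewrite mulKf.
Qed.

Let VZD c p q : 0 <= c -> A p -> A q -> (forall t, 0 <= p t) ->
  (forall t, 0 <= q t) -> V (fun t => c * p t + q t) = c * V p + V q.
Proof.
move=> c0 Ap Aq p0 q0; rewrite VD ?VZ//; first by fa.
by move=> t; exact: mulr_ge0.
Qed.

Let L a := V (fun t => Num.max (a t) 0) - V (fun t => Num.max (- a t) 0).

(** The value does not depend on how [a] is written as a difference of nonnegative functions; the
    linearity of [L] rests on this freedom. *)
Let L_diff a p q : A p -> A q -> (forall t, 0 <= p t) -> (forall t, 0 <= q t) ->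
  (forall t, a t = p t - q t) -> L a = V p - V q.
Proof.
move=> Ap Aq p0 q0 apq; have Aa : A a by rewrite (funext apq); fa.
have Aap : A (fun t => Num.max (a t) 0) by fa.
have Aan : A (fun t => Num.max (- a t) 0) by fa.
have ap0 t : 0 <= Num.max (a t) 0 by rewrite le_max lexx orbT.
have an0 t : 0 <= Num.max (- a t) 0 by rewrite le_max lexx orbT.
apply/eqP; rewrite /L subr_eq addrAC eq_sym subr_eq; apply/eqP.
rewrite -!VD//; congr V; apply/funext => t; rewrite apq.
by case: (lerP (p t - q t) 0); case: (lerP (- (p t - q t)) 0); lra.
Qed.

(** The witness extends the variation linearly from the nonnegative functions; it stands for
    integration against the total variation measure. *)
Lemma dominating_functional : exists2 g, positive_functional A g &
  forall x a, A x -> A a -> (forall t, `|x t| <= a t) -> `|f x| <= g a.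
Proof.
have Lpos a : A a -> (forall t, 0 <= a t) -> L a = V a.
  move=> Aa a0; have Az : A (fun=> 0) by fa.
  rewrite (@L_diff a a (fun=> 0))//; last by move=> t; rewrite subr0.
  have := VZ (lexx 0) Az (fun=> lexx 0); under eq_fun do rewrite mul0r.
  by rewrite mul0r => ->; rewrite subr0.
exists L; last first.
  move=> x a Ax Aa xa; rewrite Lpos//; last by move=> t; exact: le_trans (xa t).
  rewrite ler_norml lerNl; apply/andP; split; last exact: f_le_V.
  rewrite -mulN1r -fZ//.
  by apply: f_le_V => [||t]; [fa|fa|rewrite mulN1r normrN].
split=> [c u v Au Av|a Aa a0]; last first.
  rewrite Lpos//; have := f_le_V (fa_cst hA 0) Aa.
  by rewrite (linear_on0 (fa_cst hA 0) lf); apply=> t; rewrite normr0.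
pose up t := Num.max (u t) 0; pose un t := Num.max (- u t) 0.
pose vp t := Num.max (v t) 0; pose vn t := Num.max (- v t) 0.
have [Aup Aun Avp Avn] : [/\ A up, A un, A vp & A vn].
  by split; rewrite /up /un /vp /vn; fa.
have mx0 (r : R) : 0 <= Num.max r 0 by rewrite le_max lexx orbT.
have up0 t : 0 <= up t by exact: mx0.
have un0 t : 0 <= un t by exact: mx0.
have vp0 t : 0 <= vp t by exact: mx0.
have vn0 t : 0 <= vn t by exact: mx0.
have mxB (r : R) : r = Num.max r 0 - Num.max (- r) 0.
  by case: (lerP r 0); case: (lerP (- r) 0); lra.
have Lu : L u = V up - V un by [].
have Lv : L v = V vp - V vn by [].
(* A negative [c] exchanges the positive and negative parts of [u]. *)
have [c0|c0] := lerP 0 c.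
  rewrite (@L_diff _ (fun t => c * up t + vp t) (fun t => c * un t + vn t)).
  - by rewrite !VZD// Lu Lv; ring.
  - by fa.
  - by fa.
  - by move=> t; rewrite addr_ge0// mulr_ge0.
  - by move=> t; rewrite addr_ge0// mulr_ge0.
  - by move=> t; rewrite {1}(mxB (u t)) {1}(mxB (v t)) /up /un /vp /vn; ring.
have c1 : 0 <= - c by rewrite oppr_ge0 ltW.
rewrite (@L_diff _ (fun t => - c * un t + vp t) (fun t => - c * up t + vn t)).
- by rewrite !VZD// Lu Lv; ring.
- by fa.
- by fa.
- by move=> t; rewrite addr_ge0// mulr_ge0.
- by move=> t; rewrite addr_ge0// mulr_ge0.
- by move=> t; rewrite {1}(mxB (u t)) {1}(mxB (v t)) /up /un /vp /vn; ring.
Qed.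

End variation.

(** * Weak convergence of real functionals *)

(* The operator [u |-> \sum_k u_k c_k] from [c0] to [A], given by a weakly
   unconditionally Cauchy series, extends to bounded sequences. *)
Definition wuc_extension (R : realType) (T : Type) (A : set (T -> R)) :=
  forall (c : nat -> T -> R) (B : R), (forall n, A (c n)) ->
    (forall n t, \sum_(i < n) `|c i t| <= B) ->
  exists (S : (nat -> R) -> T -> R) (C : R), [/\ 0 <= C,
    forall u, bounded_seq u -> A (S u),
    forall r u v, bounded_seq u -> bounded_seq v ->
      S (fun n => r * u n + v n) = fun t => r * S u t + S v t,
    forall u M, 0 <= M -> (forall n, `|u n| <= M) ->
      forall t, `|S u t| <= C * M &
    forall n, S (fun i => (i == n)%:R) = c n].

Lemma half_pow_small (R : realType) (C e : R) (N : nat) : 0 < e ->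
  exists2 k, (N <= k)%N & C * 2^-1 ^+ k <= e.
Proof.
move=> e0; set m := Num.bound `|C / e|; pose k := maxn N m.
exists k; first exact: leq_maxl.
rewrite exprVn ler_pdivrMr ?exprn_gt0// mulrC -ler_pdivrMr//.
apply: le_trans (ler_norm _) _; apply: (@le_trans _ _ m%:R).
  by rewrite ltW// archi_boundP.
rewrite -natrX ler_nat (leq_trans (leq_maxr N _))// ltnW//.
exact: ltn_expl.
Qed.

Section weak_convergence.
Context {R : realType} {T : Type} {A : set (T -> R)} (hA : function_algebra A).
Hypothesis extA : wuc_extension A.

(** Suitable signs make the values of [f] add up in absolute value, while the combination stays
    below the sum of the moduli. *)
Lemma wuc_functional_sum f (s : nat -> T -> R) n :
  linear_on A f -> (forall i, A (s i)) ->
  exists w, [/\ A w, f w = \sum_(i < n) `|f (s i)| &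
    forall t, `|w t| <= \sum_(i < n) `|s i t|].
Proof.
move=> lf As; elim: n => [|n [w [Aw fw ws]]].
  exists (fun=> 0); split=> [||t]; first by fa.
    by rewrite big_ord0 (linear_on0 (fa_cst hA 0) lf).
  by rewrite big_ord0 normr0.
have [a a1 af] := phaseP (f (s n)).
exists (fun t => a * s n t + w t); split=> [||t]; first by fa.
  by rewrite lf// af fw big_ord_recr addrC.
rewrite (le_trans (ler_normD _ _))// big_ord_recr addrC lerD//.
by rewrite normrM ler_piMl.
Qed.

(** The bound on [f] bounds the sums of the [|f (s i)|], so only finitely many terms can exceed
    [e]. *)
Lemma wuc_functional_cvg0 f (s : nat -> T -> R) B :
  bounded_functional A f -> (forall i, A (s i)) ->
  (forall n t, \sum_(i < n) `|s i t| <= B) ->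
  forall e, 0 < e -> exists I, forall i, (I <= i)%N -> `|f (s i)| <= e.
Proof.
move=> [lf [C C0 fC]] As sB e e0.
have B0 : 0 <= `|B| by [].
have bnd n : \sum_(i < n) `|f (s i)| <= C * `|B|.
  have [w [Aw <- ws]] := wuc_functional_sum n lf As.
  apply: le_trans (ler_norm _) (fC _ _ B0 Aw _) => t.
  by apply: (le_trans (ws t)); exact: le_trans (sB n t) (ler_norm B).
apply: contrapT => h.
have h' I : exists2 i, (I <= i)%N & e < `|f (s i)|.
  apply: contrapT => h'; apply: h; exists I => i Ii.
  by rewrite leNgt; apply/negP => ?; apply: h'; exists i.
have grow m : exists n, m%:R * e <= \sum_(i < n) `|f (s i)|.
  elim: m => [|m [n IH]]; first by exists 0%N; rewrite mul0r big_ord0.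
  have [i ni ei] := h' n; exists i.+1.
  rewrite big_ord_recr/= -natr1 mulrDl mul1r lerD ?(ltW ei)//.
  apply: (le_trans IH); rewrite -(subnKC ni) big_split_ord/= lerDl.
  exact: sumr_ge0.
have [n] := grow (Num.bound (C * `|B| / e)).
move=> /le_trans /(_ (bnd n)); rewrite -ler_pdivlMr// leNgt => /negP; apply.
by apply: archi_boundP; rewrite divr_ge0 ?mulr_ge0 ?(ltW e0).
Qed.

Variable f : nat -> (T -> R) -> R.
Hypothesis bf : forall n, bounded_functional A (f n).
Hypothesis f0 : forall a, A a -> forall e, 0 < e ->
  exists N, forall n, (N <= n)%N -> `|f n a| <= e.

Let lf n : linear_on A (f n) := (bf n).1.

(* [dominated n b e] says that the variation of [f n] is at most [e] at [b]. *)
Let dominated n b e := forall s, A s -> (forall t, `|s t| <= b t) -> `|f n s| <= e.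

Let dominatedS n b c e : (forall t, b t <= c t) -> dominated n c e -> dominated n b e.
Proof.
by move=> bc dc s As sb; apply: dc => // t; exact: le_trans (sb t) (bc t).
Qed.

Let dominated_le n b e e' : e <= e' -> dominated n b e -> dominated n b e'.
Proof. by move=> ee' db s As sb; exact: le_trans (db s As sb) ee'. Qed.

Let dominatedD n b c e e' : A b -> (forall t, 0 <= b t) -> (forall t, 0 <= c t) ->
  dominated n b e -> dominated n c e' -> dominated n (fun t => b t + c t) (e + e').
Proof.
move=> Ab b0 c0 db dc s As sbc.
pose y t := Num.max (- b t) (Num.min (s t) (b t)).
have Ay : A y by rewrite /y; fa.
have bnd t : `|y t| <= b t /\ `|s t - y t| <= c t.
  exact: clamp_split.
have -> : s = fun t => y t + (s t - y t) by apply/funext => t; rewrite addrC subrK.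
rewrite (linear_onD (lf n))//; last by fa.
rewrite (le_trans (ler_normD _ _))// lerD//.
  by apply: db => // t; case: (bnd t).
by apply: dc => [|t]; [fa|case: (bnd t)].
Qed.

(** Otherwise there are bad pairs of a term and a functional with both indices going to infinity.
    Their subseries extends to bounded sequences by [extA], the composed functionals are pointwise
    null, and [phillips] makes a diagonal value smaller than [e]. *)
Lemma wuc_uniformly_small (s : nat -> T -> R) B : (forall i, A (s i)) ->
  (forall n t, \sum_(i < n) `|s i t| <= B) ->
  forall e, 0 < e -> exists I, forall i n, (I <= i)%N -> `|f n (s i)| <= e.
Proof.
move=> As sB e e0; apply: contrapT => h.
(* Finitely many functionals are treated one at a time, which forces the functional indices of bad
   pairs to infinity. *)
have small N : exists I, forall i n, (I <= i)%N -> (n < N)%N -> `|f n (s i)| <= e.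
  elim: N => [|N [I IP]]; first by exists 0%N.
  have [I' I'P] := wuc_functional_cvg0 (bf N) As sB e0.
  exists (maxn I I') => i n; rewrite geq_max ltnS => /andP[Ii I'i].
  by rewrite leq_eqVlt => /predU1P[->|nN]; [exact: I'P|exact: IP].
have /choice[q qP] N : exists q : nat * nat,
    [/\ (N <= q.1)%N, (N <= q.2)%N & e < `|f q.2 (s q.1)|].
  apply: contrapT => h'; apply: h; have [I IP] := small N.
  exists (maxn N I) => i n; rewrite geq_max => /andP[Ni Ii].
  have [nN|Nn] := ltnP n N; first exact: IP.
  by rewrite leNgt; apply/negP => ?; apply: h'; exists (i, n).
pose p := fix p k := if k is k'.+1 then q (maxn (p k').1 (p k').2).+1 else q 0%N.
have pe k : e < `|f (p k).2 (s (p k).1)|.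
  have [J ->] : exists J, p k = q J by case: k => [|k]; eexists.
  by case: (qP J).
have p1 k : ((p k).1 < (p k.+1).1)%N.
  by rewrite /=; case: (qP (maxn (p k).1 (p k).2).+1) => + _ _; rewrite gtn_max => /andP[].
have p2 k : (k <= (p k).2)%N.
  elim: k => // k IH; apply: (leq_ltn_trans IH).
  by rewrite /=; case: (qP (maxn (p k).1 (p k).2).+1) => _ + _; rewrite gtn_max => /andP[].
have sub m t : \sum_(k < m) `|s (p k).1 t| <= \sum_(i < (p m).1) `|s i t|.
  elim: m => [|m IH]; first by rewrite big_ord0 sumr_ge0.
  rewrite big_ord_recr/= -(subnKC (p1 m)) big_split_ord/= big_ord_recr/=.
  by rewrite -[X in X <= _]addr0 lerD ?sumr_ge0// lerD.
have [S [C [C0 AS lS bS Sdelta]]] := extA (fun k => As (p k).1)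
  (fun m t => le_trans (sub m t) (sB _ t)).
pose nu k u := f (p k).2 (S u).
have [|||k] := @phillips R nu e e0.
- by move=> k r u v bu bv; rewrite /nu lS// lf//; exact: AS.
- move=> k; have [_ [D D0 fD]] := bf (p k).2; exists (D * C) => u M M0 bu uM.
  rewrite -mulrA; apply: fD; [by rewrite mulr_ge0|exact: AS|exact: bS].
- move=> u bu d d0; have [N NP] := f0 (AS _ bu) d0.
  by exists N => k Nk; apply: NP; exact: leq_trans Nk (p2 k).
by rewrite /nu Sdelta ltNge ltW.
Qed.

(** Uniform countable additivity: if it fails, bad increments over successive index ranges telescope
    to a weakly unconditionally Cauchy series that contradicts [wuc_uniformly_small]. *)
Lemma monotone_uniformly_cauchy (x : nat -> T -> R) B : (forall j, A (x j)) ->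
  (forall j k t, (j <= k)%N -> x j t <= x k t) -> (forall j t, `|x j t| <= B) ->
  forall e, 0 < e -> exists J, forall j k n, (J <= j)%N -> (j <= k)%N ->
    dominated n (fun t => x k t - x j t) e.
Proof.
move=> Ax xmono xB e e0; apply: contrapT => h.
have /choice[q qP] J : exists q : nat * nat * nat * (T -> R),
    [/\ (J <= q.1.1.1)%N, (q.1.1.1 <= q.1.1.2)%N, A q.2,
      forall t, `|q.2 t| <= x q.1.1.2 t - x q.1.1.1 t & e < `|f q.1.2 q.2|].
  apply: contrapT => h'; apply: h; exists J => j k n Jj jk s As sx.
  by rewrite leNgt; apply/negP => ?; apply: h'; exists (j, k, n, s).
pose p := fix p i := if i is i'.+1 then q (p i').1.1.2 else q 0%N.
have pq i : exists J, p i = q J by case: i => [|i]; eexists.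
have As i : A (p i).2 by have [J ->] := pq i; case: (qP J).
have sum m t : \sum_(i < m) `|(p i).2 t| <= x (p m).1.1.1 t - x 0%N t.
  elim: m => [|m IH]; first by rewrite big_ord0 subr_ge0 xmono.
  rewrite big_ord_recr/=.
  have : x (p m).1.1.2 t <= x (p m.+1).1.1.1 t.
    by apply: xmono; rewrite /=; case: (qP (p m).1.1.2).
  have : `|(p m).2 t| <= x (p m).1.1.2 t - x (p m).1.1.1 t.
    by have [J ->] := pq m; case: (qP J).
  rewrite /=; lra.
have [|I IP] := wuc_uniformly_small As (B := 2 * B) _ e0.
  move=> m t; apply: (le_trans (sum m t)).
  have := xB (p m).1.1.1 t; have := xB 0%N t.
  by rewrite !ler_norml => /andP[? ?] /andP[? ?]; lra.
have := IP I (p I).1.2 (leqnn I); rewrite leNgt => /negP; apply.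
by have [J ->] := pq I; case: (qP J).
Qed.

(* The Borel-Cantelli argument for uniformly countably additive measures: [y m]
   plays the role of [\bigcap_(k <= m) \bigcup_(l >= k) b l]. *)
Lemma uniformly_absolutely_continuous (b : nat -> T -> R) B : (forall j, A (b j)) ->
  (forall j t, 0 <= b j t) -> (forall j t, b j t <= B) ->
  (forall n, exists C, forall j, (n <= j)%N -> dominated n (b j) (C * 2^-1 ^+ j)) ->
  forall e, 0 < e -> exists J, forall j n, (J <= j)%N -> dominated n (b j) e.
Proof.
move=> Ab b0 bB bC e e0.
(* [x k d] is the maximum of the functions [b k] to [b (k + d)]. *)
pose x k := fix x d := if d is d'.+1 then
  fun t => Num.max (x d' t) (b (k + d)%N t) else b k.
have Ax k d : A (x k d) by elim: d => [|d IH] //=; fa.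
have xS k d t : x k d t <= x k d.+1 t by rewrite /= le_max lexx.
have xmono k d d' t : (d <= d')%N -> x k d t <= x k d' t.
  move=> /subnKC <-; elim: (d' - d)%N => [|m IH]; first by rewrite addn0.
  by rewrite addnS (le_trans IH).
have x0 k d t : 0 <= x k d t by apply: le_trans (xmono k 0%N d t _) => /=.
have xB k d t : x k d t <= B by elim: d => //= d IH; rewrite ge_max IH bB.
have bx k d t : b (k + d)%N t <= x k d t.
  by case: d => [|d]; [rewrite addn0|rewrite /= le_max lexx orbT].
(* The constant is the geometric sum of the [C * 2^-1 ^+ l] for [l] from [k] to [k + d]. *)
have xC n C : (forall j, (n <= j)%N -> dominated n (b j) (C * 2^-1 ^+ j)) ->
    forall k d, (n <= k)%N ->
    dominated n (x k d) (C * (2 * 2^-1 ^+ k - 2^-1 ^+ (k + d))).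
  move=> nC k d nk; elim: d => [|d IH].
    by rewrite addn0 mulr_natl mulr2n addrK; exact: nC.
  have -> : C * (2 * 2^-1 ^+ k - 2^-1 ^+ (k + d.+1)) =
      C * (2 * 2^-1 ^+ k - 2^-1 ^+ (k + d)) + C * 2^-1 ^+ (k + d.+1).
    by rewrite addnS exprS; field.
  apply: (@dominatedS n _ (fun t => x k d t + b (k + d.+1)%N t)).
    by move=> t; rewrite /= ge_max lerDl b0/= lerDr x0.
  apply: dominatedD => //; apply: nC; exact: leq_trans nk (leq_addr _ _).
(* From stage [D k] on, the increasing sequence [x k] moves by at most [e / 4 * 2^-1 ^+ k] for all
   functionals at once. *)
have /choice[D DP] k : exists D, forall d n, (D <= d)%N ->
    dominated n (fun t => x k d t - x k D t) (e / 4 * 2^-1 ^+ k).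
  have ek : 0 < e / 4 * 2^-1 ^+ k by rewrite mulr_gt0 ?exprn_gt0// divr_gt0.
  have [|J JP] := monotone_uniformly_cauchy (Ax k) (B := B) (xmono k) _ ek.
    by move=> d t; rewrite ger0_norm.
  by exists J => d n Jd; exact: JP.
pose y := fix y m := if m is m'.+1 then
  fun t => Num.min (y m' t) (x m (D m) t) else x 0%N (D 0%N).
have Ay m : A (y m) by elim: m => [|m IH] //=; fa.
have y0 m t : 0 <= y m t by elim: m => //= m IH; rewrite le_min IH x0.
have yS m t : y m.+1 t <= y m t by rewrite /= ge_min lexx.
have ymono j k t : (j <= k)%N -> y k t <= y j t.
  move=> /subnKC <-; elim: (k - j)%N => [|m IH]; first by rewrite addn0.
  by rewrite addnS (le_trans (yS _ t)).
have yx m t : y m t <= x m (D m) t by case: m => //= m; rewrite ge_min lexx orbT.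
have e4 : 0 < e / 4 by rewrite divr_gt0.
have [|||J JP] := monotone_uniformly_cauchy (x := fun m t => - y m t) (B := B) _ _ _ e4.
- by move=> m; fa.
- by move=> j k t jk; rewrite lerN2 ymono.
- by move=> m t; rewrite normrN ger0_norm// (le_trans (yx m t)).
(* For fixed [n] the variation at [y k] is small for late [k], at a rate depending on [n]; the
   uniform Cauchy property of [y] carries this back to [J], which does not depend on [n]. *)
have yJ n : dominated n (y J) (e / 2).
  have [C CP] := bC n.
  have [k] := half_pow_small (2 * C) (maxn n J) e4.
  rewrite geq_max => /andP[nk Jk] small.
  apply: (@dominatedS n _ (fun t => (y J t - y k t) + y k t)).
    by move=> t; rewrite subrK.
  have -> : e / 2 = e / 4 + e / 4 by field.
  apply: dominatedD => //; first by fa.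
  - by move=> t; rewrite subr_ge0 ymono.
  - apply: dominatedS (JP J k n (leqnn J) Jk) => t; lra.
  apply: (dominatedS (yx k)); apply: dominated_le small _.
  have := xC n C CP k (D k) nk; apply: dominated_le.
  have C0 : 0 <= C * 2^-1 ^+ (k + D k).
    have := CP (k + D k)%N (leq_trans nk (leq_addr _ _)) (fun=> 0) (fa_cst hA 0).
    by rewrite (linear_on0 (fa_cst hA 0) (lf n)) normr0; apply.
  lra.
exists J => k n Jk.
(* [z i] is the cost of stopping [x i] at [D i] instead of at a stage that covers [b k]; the
   variations at these costs add up to at most [e / 2]. *)
pose z i t := x i (maxn (D i) (k - i)) t - x i (D i) t.
have Az i : A (z i) by rewrite /z; fa.
have z0 i t : 0 <= z i t by rewrite subr_ge0 xmono// leq_maxl.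
pose w m t := \sum_(i < m) z i t.
have wS m : w m.+1 = fun t => w m t + z m t.
  by apply/funext => t; rewrite /w big_ord_recr.
have w0 m t : 0 <= w m t by rewrite sumr_ge0.
have Aw m : A (w m).
  elim: m => [|m IH]; last by rewrite wS; fa.
  by rewrite (_ : w 0%N = fun=> 0); [fa|apply/funext => t; rewrite /w big_ord0].
have dw m : dominated n (w m) (e / 2 - e / 2 * 2^-1 ^+ m).
  elim: m => [|m IH].
    rewrite expr0 mulr1 subrr => s As sw.
    have -> : s = fun=> 0.
      apply/funext => t; apply/normr0_eq0/le_anti; rewrite normr_ge0 andbT.
      by rewrite (le_trans (sw t))// /w big_ord0.
    by rewrite (linear_on0 (fa_cst hA 0) (lf n)) normr0.
  rewrite wS; have -> : e / 2 - e / 2 * 2^-1 ^+ m.+1 =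
    e / 2 - e / 2 * 2^-1 ^+ m + e / 4 * 2^-1 ^+ m by rewrite exprS; field.
  by apply: dominatedD => //; apply: DP; exact: leq_maxl.
have bz i t : (i <= k)%N -> b k t <= x i (D i) t + z i t.
  move=> ik; rewrite addrC subrK -{1}(subnKC ik) (le_trans (bx _ _ _))//.
  by apply: xmono; exact: leq_maxr.
have byw m t : (m <= k)%N -> b k t <= y m t + w m.+1 t.
  elim: m => [|m IH] mk.
    by rewrite (le_trans (bz 0%N t mk))// lerD2l wS lerDr.
  rewrite wS /= -/(y m); have := IH (ltnW mk); have := bz _ t mk.
  have := z0 m.+1 t; have := w0 m.+1 t.
  by case: (lerP (y m t) (x m.+1 (D m.+1) t)); lra.
apply: (@dominatedS n _ (fun t => y k t + w k.+1 t)); first by move=> t; exact: byw.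
have -> : e = e / 2 + e / 2 by field.
apply: dominatedD => //; first by apply: dominatedS (yJ n) => t; exact: ymono.
apply: dominated_le (dw k.+1).
by rewrite gerBl// mulr_ge0 ?exprn_ge0// divr_ge0// ltW.
Qed.

Lemma weak_null M Phi : 0 < M -> bidual_form A M Phi ->
  forall e, 0 < e -> exists N, forall n, (N <= n)%N -> `|Phi (f n)| <= e.
Proof.
move=> M0 hPhi.
have /choice[L LP] n : exists g, positive_functional A g /\
    forall x a, A x -> A a -> (forall t, `|x t| <= a t) -> `|f n x| <= g a.
  by have [g] := dominating_functional hA (bf n); exists g.
(* The form [g j] controls [f 0] to [f j] together, so that one vector [a j] serves them all. *)
pose g j x := \sum_(n < j.+1) L n x.
have gpos j : positive_functional A (g j).
  split=> [c u v Au Av|a Aa a0]; last by apply: sumr_ge0 => n _; apply: (LP n).1.2.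
  rewrite /g mulr_sumr -big_split/=; apply: eq_bigr => n _.
  by rewrite (LP n).1.1.
have Lq n x : A x -> 0 <= L n (fun t => x t * x t).
  by move=> Ax; apply: (LP n).1.2 => [|t]; [fa|rewrite -expr2 sqr_ge0].
have gq j x : A x -> 0 <= g j (fun t => x t * x t).
  by move=> Ax; apply: sumr_ge0 => n _; exact: Lq.
have gmono j k x : (j <= k)%N -> A x ->
    g j (fun t => x t * x t) <= g k (fun t => x t * x t).
  move=> jk Ax; rewrite /g -!(big_mkord xpredT (fun n => L n _)).
  rewrite (@big_cat_nat _ _ _ j.+1 0 k.+1)//= lerDl.
  by apply: sumr_ge0 => n _; exact: Lq.
have Lg n j x : (n <= j)%N -> A x ->
    L n (fun t => x t * x t) <= g j (fun t => x t * x t).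
  move=> nj Ax; have nj' : (n < j.+1)%N by [].
  by rewrite /g (bigD1 (Ordinal nj'))//= lerDl sumr_ge0// => i _; exact: Lq.
(* The square root comes from Cauchy-Schwarz against the constant 1; the added 1 makes [c n]
   positive. *)
pose c n := Num.sqrt (L n (fun=> 1)) + 1.
have L1 n : 0 <= L n (fun=> 1) by apply: (LP n).1.2 => //; exact: fa_cst hA 1.
have c0 n : 0 < c n by rewrite ltr_wpDl// sqrtr_ge0.
have Lc n j x : (n <= j)%N -> A x ->
    L n (fun t => `|x t|) <= c n * Num.sqrt (g j (fun t => x t * x t)).
  move=> nj Ax; have A1 : A (fun=> 1) by fa.
  have Ax' : A (fun t => `|x t|) by fa.
  have := form_cauchy hA (LP n).1.1 (LP n).1.2 Ax' A1.
  under eq_fun do rewrite mulr1.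
  under [X in _ <= L n X * _ -> _]eq_fun
    do rewrite -normrM ger0_norm -?expr2 ?sqr_ge0// expr2.
  under [X in _ <= _ * L n X -> _]eq_fun do rewrite mulr1.
  move=> h; apply: le_trans (ler_norm _) _; apply: sqr_le_norm.
    by rewrite mulr_ge0 ?sqrtr_ge0// ltW.
  apply: (le_trans h); rewrite exprMn sqr_sqrtr ?gq// mulrC.
  apply: ler_pM => //; [exact: Lq| |exact: Lg].
  rewrite -[X in X <= _]sqr_sqrtr// ler_pXn2r ?nnegrE ?sqrtr_ge0 ?(ltW (c0 n))//.
  by rewrite lerDl.
have h2 j : 0 < 2^-1 ^+ j :> R by rewrite exprn_gt0.
have /choice[a aP] j : exists a, [/\ A a, forall t, `|a t| <= M &
    forall h r, 0 < r -> linear_on A h ->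
    (forall x, A x -> h x ^+ 2 <= r ^+ 2 * g j (fun t => x t * x t)) ->
    `|Phi h - h a| <= 2^-1 ^+ j * r].
  have [a [Aa aM] aP] := bidual_approximation hA (gpos j) M0 hPhi (h2 j).
  by exists a.
have Aa j : A (a j) by case: (aP j).
have f_lim n j : (n <= j)%N -> `|Phi (f n) - f n (a j)| <= 2^-1 ^+ j * c n.
  move=> nj; have [_ _] := aP j; apply=> // x Ax.
  have Ax' : A (fun t => `|x t|) by fa.
  have h : `|f n x| <= c n * Num.sqrt (g j (fun t => x t * x t)).
    apply: le_trans (Lc n j x nj Ax).
    exact: (LP n).2.
  rewrite -[X in X <= _]real_normK ?num_real// -[X in _ <= _ * X]sqr_sqrtr ?gq//.
  by rewrite -exprMn ler_pXn2r ?nnegrE ?mulr_ge0 ?sqrtr_ge0// ltW.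
have a_cauchy n j k : (n <= j)%N -> (j <= k)%N ->
    dominated n (fun t => `|a k t - a j t|) (2 * c n * 2^-1 ^+ j).
  move=> nj jk; set y := fun t => a k t - a j t.
  have Ay : A y by rewrite /y; have := Aa j; have := Aa k; move=> ? ?; fa.
  have Ay' : A (fun t => `|y t|) by fa.
  have ry : Num.sqrt (g j (fun t => y t * y t)) <= 2 * 2^-1 ^+ j.
    set r := Num.sqrt _; have r0 : 0 <= r by exact: sqrtr_ge0.
    have [->|rn0] := eqVneq r 0; first by rewrite mulr_ge0// ltW.
    have rp : 0 < r by rewrite lt0r rn0.
    (* [a j] and [a k] both approximate [Phi h], and the values of [h] at these points differ by
       [r ^+ 2]; dividing by [r] bounds the distance. *)
    pose h x := g j (fun t => y t * x t).
    have lh : linear_on A h.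
      move=> d u v Au Av; rewrite /h -(gpos j).1; try by fa.
      by congr (g j _); apply/funext => t; ring.
    have hj x : A x -> h x ^+ 2 <= r ^+ 2 * g j (fun t => x t * x t).
      move=> Ax; rewrite sqr_sqrtr ?gq//.
      exact: (form_cauchy hA (gpos j).1 (gpos j).2).
    have hk x : A x -> h x ^+ 2 <= r ^+ 2 * g k (fun t => x t * x t).
      by move=> Ax; apply: (le_trans (hj x Ax)); rewrite ler_wpM2l ?sqr_ge0// gmono.
    have [_ _ /(_ h r rp lh hj) e1] := aP j.
    have [_ _ /(_ h r rp lh hk) e2] := aP k.
    have e3 : r ^+ 2 = h (a k) - h (a j).
      by rewrite sqr_sqrtr ?gq// -(linear_onB lh).
    have e4 : 2^-1 ^+ k * r <= 2^-1 ^+ j * r.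
      by rewrite ler_pM2r// ler_wiXn2l// ?invr_ge0// invf_le1// ler1n.
    move: e1 e2; rewrite !ler_norml => /andP[? ?] /andP[? ?].
    have : r * r <= (2 * 2^-1 ^+ j) * r by rewrite -expr2; lra.
    by rewrite ler_pM2r.
  move=> s As sy; apply: (le_trans ((LP n).2 s _ As Ay' sy)).
  apply: (le_trans (Lc n j y nj Ay)).
  by rewrite mulrAC [2 * _ * _]mulrC ler_wpM2l// ltW.
have unif e : 0 < e -> exists J, forall j k n, (J <= j)%N -> (j <= k)%N ->
    `|f n (a k) - f n (a j)| <= e.
  move=> e0; apply: contrapT => h.
  have /choice[q qP] i : exists q : nat * nat * nat,
      [/\ (i <= q.1.1)%N, (q.1.1 <= q.1.2)%N &
        e < `|f q.2 (a q.1.2) - f q.2 (a q.1.1)|].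
    apply: contrapT => h'; apply: h; exists i => j k n ij jk.
    by rewrite leNgt; apply/negP => ?; apply: h'; exists (j, k, n).
  (* For each fixed [n] the variation at [b i] decays like [2^-1 ^+ i], so uniform absolute
     continuity rules out the bad triples. *)
  pose b i t := `|a (q i).1.2 t - a (q i).1.1 t|.
  have Ay i : A (fun t => a (q i).1.2 t - a (q i).1.1 t).
    by have := Aa (q i).1.2; have := Aa (q i).1.1; move=> ? ?; fa.
  have [||||J JP] := @uniformly_absolutely_continuous b (2 * M) _ _ _ _ _ e0.
  - by move=> i; exact: fa_norm.
  - by move=> i t; exact: normr_ge0.
  - move=> i t; rewrite /b.
    have [_ /(_ t) + _] := aP (q i).1.1; have [_ /(_ t) + _] := aP (q i).1.2.
    rewrite !ler_norml => /andP[? ?] /andP[? ?]; apply/andP; split; lra.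
  - move=> n; exists (2 * c n) => i ni; have [iq qq _] := qP i.
    apply: dominated_le (a_cauchy n _ _ (leq_trans ni iq) qq).
    rewrite ler_wpM2l ?mulr_ge0 ?(ltW (c0 n))//.
    by rewrite ler_wiXn2l// ?invr_ge0// invf_le1// ler1n.
  have [_ _] := qP J; rewrite -(linear_onB (lf _))// ltNge => /negP; apply.
  by apply: (JP J) => // t.
(* [J] is chosen for all functionals at once, then [N] for the single function [a J]; only [k]
   depends on [n]. *)
move=> e e0; have e3 : 0 < e / 3 by rewrite divr_gt0.
have [J JP] := unif _ e3; have [N NP] := f0 (Aa J) e3.
exists N => n Nn; have [k] := half_pow_small (c n) (maxn n J) e3.
rewrite geq_max mulrC => /andP[nk Jk] small.
have := f_lim n k nk; have := JP J k n (leqnn J) Jk; have := NP n Nn.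
rewrite !ler_norml => /andP[? ?] /andP[? ?] /andP[? ?]; apply/andP; split; lra.
Qed.

End weak_convergence.

(** * Scalars and dual spaces *)

Section scalar_parts.
Context {R : realType} {s : scalars}.
Local Notation F := (scalar_field R s).
Implicit Types (z w : F) (r : R).

Definition rpart : F -> R :=
  match s return scalar_field R s -> R with
  | RealScalars => fun r => r
  | ComplexScalars => fun z : R[i] => complex.Re z
  end.

Definition ipart : F -> R :=
  match s return scalar_field R s -> R with
  | RealScalars => fun=> 0
  | ComplexScalars => fun z : R[i] => complex.Im z
  end.

(** The value 0 over the reals, where imaginary parts vanish, keeps [partsE] true for both
    fields. *)
Definition iunit : F :=
  match s return scalar_field R s with
  | RealScalars => 0
  | ComplexScalars => 'i%C
  end.

Lemma rpartD z w : rpart (z + w) = rpart z + rpart w.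
Proof. by rewrite /rpart; move: z w; case: s => //= -[? ?] [? ?]. Qed.

Lemma ipartD z w : ipart (z + w) = ipart z + ipart w.
Proof. by rewrite /ipart; move: z w; case: s => [? ?|[? ?] [? ?]]/=; rewrite ?addr0. Qed.

Lemma rpartZ r z : rpart (ofreal s r * z) = r * rpart z.
Proof. by rewrite /rpart; move: z; case: s => //= -[? ?]/=; rewrite mul0r subr0. Qed.

Lemma ipartZ r z : ipart (ofreal s r * z) = r * ipart z.
Proof.
rewrite /ipart; move: z; case: s => [?|[? ?]]/=; first by rewrite mulr0.
by rewrite mul0r addr0.
Qed.

Lemma rpart_ofreal r : rpart (ofreal s r) = r.
Proof. by rewrite /rpart; case: s. Qed.

Lemma partsE z : z = ofreal s (rpart z) + iunit * ofreal s (ipart z).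
Proof.
rewrite /rpart /ipart /iunit; move: z; case: s => [?|[a b]]/=.
  by rewrite mul0r addr0.
by simpc.
Qed.

Lemma modulus_ofreal r : modulus (ofreal s r) = `|r|.
Proof.
apply: (@ofreal_inj R s); rewrite ofreal_modulus; case: s => //=.
by rewrite normc_def/= expr0n addr0 sqrtr_sqr.
Qed.

Lemma ler_rpart_modulus z : `|rpart z| <= modulus z.
Proof.
rewrite /rpart /modulus; move: z; case: s => //= -[a b]/=.
by rewrite -sqrtr_sqr ler_wsqrtr// lerDl sqr_ge0.
Qed.

Lemma ler_ipart_modulus z : `|ipart z| <= modulus z.
Proof.
rewrite /ipart /modulus; move: z; case: s => [x|[a b]]/=; first by rewrite normr0.
by rewrite -sqrtr_sqr ler_wsqrtr// lerDr sqr_ge0.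
Qed.

Lemma modulus_iunit : modulus iunit <= 1.
Proof.
rewrite /iunit /modulus; case: s => //=; first by rewrite normr0.
by rewrite expr0n add0r expr1n sqrtr1.
Qed.

Lemma modulus_parts z (a b : R) : `|rpart z| <= a -> `|ipart z| <= b ->
  modulus z <= a + b.
Proof.
move=> za zb; rewrite {1}(partsE z) (le_trans (modulusD _ _))// lerD//.
  by rewrite modulus_ofreal.
rewrite modulusM modulus_ofreal (le_trans _ zb)// ler_piMl//.
exact: modulus_iunit.
Qed.

Lemma ler_norm_ofreal z r : (`|z| <= ofreal s r) = (modulus z <= r).
Proof. by rewrite -ofreal_modulus ler_ofreal. Qed.

Lemma ofreal_ge0P z : 0 <= z -> z = ofreal s (modulus z).
Proof. by move=> z0; rewrite ofreal_modulus ger0_norm. Qed.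

Lemma rpartB z w : rpart (z - w) = rpart z - rpart w.
Proof. by apply/eqP; rewrite eq_sym subr_eq -rpartD subrK. Qed.

Lemma ipartB z w : ipart (z - w) = ipart z - ipart w.
Proof. by apply/eqP; rewrite eq_sym subr_eq -ipartD subrK. Qed.

Lemma ofrealB (a b : R) : ofreal s (a - b) = ofreal s a - ofreal s b.
Proof. by apply/eqP; rewrite eq_sym subr_eq -ofrealD subrK. Qed.

(** Lets tolerances range over [R] rather than over the positive elements of [F]. *)
Lemma cvg_scalarP (T : Type) (G : set_system T) (h : T -> F^o) (l : F^o) :
  Filter G -> h @ G --> l <->
  forall e, 0 < e -> \forall x \near G, modulus (l - h x) <= e.
Proof.
move=> FG; split=> [/cvgrPdist_le hl e e0|hl].
  have e0' : 0 < ofreal s e.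
    by rewrite -(@ofreal0 R s) lt_neqAle ler_ofreal (inj_eq (@ofreal_inj R s)) -lt_neqAle.
  by apply: filterS (hl _ e0') => x; rewrite ler_norm_ofreal.
apply/cvgrPdist_le => e e0; rewrite (ofreal_ge0P (ltW e0)).
have /hl : 0 < modulus e.
  rewrite lt0r modulus_ge0 andbT; apply/eqP => /modulus_eq0 e00.
  by rewrite e00 ltxx in e0.
by apply: filterS => x; rewrite ler_norm_ofreal.
Qed.

Lemma rpart_continuous : continuous (rpart : F^o -> R).
Proof.
move=> z; apply/(@cvgrPdist_le _ R _ (nbhs (z : F^o)) (nbhs_filter _)) => e e0.
have /(_ e e0) := (@cvg_scalarP _ (nbhs (z : F^o)) id z (nbhs_filter _)).1 (@cvg_id _ _).
apply: (@filterS _ (nbhs (z : F^o)) (nbhs_filter _)) => w.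
by rewrite -rpartB; exact: le_trans (ler_rpart_modulus _).
Qed.

Lemma ipart_continuous : continuous (ipart : F^o -> R).
Proof.
move=> z; apply/(@cvgrPdist_le _ R _ (nbhs (z : F^o)) (nbhs_filter _)) => e e0.
have /(_ e e0) := (@cvg_scalarP _ (nbhs (z : F^o)) id z (nbhs_filter _)).1 (@cvg_id _ _).
apply: (@filterS _ (nbhs (z : F^o)) (nbhs_filter _)) => w.
by rewrite -ipartB; exact: le_trans (ler_ipart_modulus _).
Qed.

Lemma ofreal_continuous : continuous (ofreal s : R -> F^o).
Proof.
move=> r; apply/(@cvg_scalarP _ (nbhs r)) => e e0.
have /cvgrPdist_le/(_ e e0) := @cvg_id _ (nbhs r).
by apply: filterS => x; rewrite -ofrealB modulus_ofreal.
Qed.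

End scalar_parts.
Arguments iunit {R s}.

Section weak_topologies.
Context {R : realType} {s : scalars} {X : normedModType (scalar_field R s)}.
Local Notation F := (scalar_field R s).

Lemma weak_star_cvg (T : Type) (G : set_system T) (u : T -> dual X) (f : dual X) :
  Filter G -> (u : T -> weak_star X) @ G --> (f : weak_star X) ->
  forall x, (fun i => u i x) @ G --> f x.
Proof.
move=> FG uf x.
have h := cvg_comp _ _ uf (@initial_continuous _ _ _ (f : weak_star X)).
exact: ((pointwise_cvgP _ _).1 h x).
Qed.

Lemma weak_cvg (u : nat -> X) (x : X) :
  (forall f : dual X, (fun n => f (u n)) @ \oo --> f x) ->
  (u : nat -> weak X) @ \oo --> (x : weak X).
Proof.
move=> h.
have pt : (fun n => (canonical_embedding (u n) : {ptws dual X -> F^o})) @ \oo -->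
    (canonical_embedding x : {ptws dual X -> F^o}).
  by apply/pointwise_cvgP => f; exact: h.
move=> U [?/= [[W oW <-]]] /= Wx /filterS; apply; apply: pt.
exact: open_nbhs_nbhs.
Qed.

Lemma dual_norm_le (f : dual X) (M : F) : 0 <= M ->
  (forall x, `|f x| <= M * `|x|) -> `|f| <= M.
Proof.
move=> M0 fM; rewrite (ofreal_ge0P M0); apply: supnorm_le => [|x x1].
  exact: modulus_ge0.
rewrite -(@ler_ofreal R s) ofreal_modulus -ofreal_ge0P//.
by rewrite (le_trans (fM x))// ler_piMr.
Qed.

End weak_topologies.

Section cspace_norm.
Context {R : realType} {s : scalars} {K : compactHausdorffType}.
Local Notation F := (scalar_field R s).
Implicit Types a : cspace R s K.

Lemma ler_cspace_norm a t : `|a t| <= `|a|.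
Proof. by apply: modulus_le_supnorm => //; exact: cspace_modulus_bounded. Qed.

Lemma cspace_norm_le a (M : F) : 0 <= M -> (forall t, `|a t| <= M) -> `|a| <= M.
Proof.
move=> M0 aM; rewrite (ofreal_ge0P M0); apply: supnorm_le => [|t _].
  exact: modulus_ge0.
by rewrite -ler_norm_ofreal -ofreal_ge0P.
Qed.

End cspace_norm.

(** * The contractive retraction of the bidual onto C(K) *)

Section bidual_projection.
Context {R : realType} {s : scalars} {Y : normedModType (scalar_field R s)}
  {K : compactHausdorffType}.
Local Notation F := (scalar_field R s).
Local Notation X := (cspace R s K).
Variables (J : {linear X -> dual Y}) (rho : K -> dual (dual Y)).
Hypothesis J_iso : forall a, `|J a| = `|a|.
Hypothesis rho_cont : continuous (rho : K -> weak_star (dual Y)).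
Hypothesis rhoE : forall t,
  (forall a, rho t (J a) = dirac_functional t a) /\ `|rho t| = 1.

Let ev_in_dual y : (fun a => J a y : F^o) \in @dual_pred R s X.
Proof.
apply: (@bounded_in_dual _ _ _ _ `|y|) => // [c a b|a].
  by rewrite linearP.
by rewrite mulrC -J_iso ler_dual_norm.
Qed.

Let ev y : dual X := Dual (ev_in_dual y).

Let ev_le y : `|ev y| <= `|y|.
Proof. by apply: dual_norm_le => // a /=; rewrite mulrC -J_iso ler_dual_norm. Qed.

Let restr_in_dual (phi : dual (dual X)) :
  (fun y => phi (ev y) : F^o) \in @dual_pred R s Y.
Proof.
apply: (@bounded_in_dual _ _ _ _ `|phi|) => // [c y y'|y].
  rewrite -linearP; congr (phi _); apply/val_inj/funext => a /=.
  exact: linearP.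
apply: (le_trans (ler_dual_norm phi (ev y))); by rewrite ler_wpM2l.
Qed.

Let restr phi : dual Y := Dual (restr_in_dual phi).

Let proj_in_cspace phi : (fun t => rho t (restr phi) : F^o) \in @cspace_pred R s K.
Proof. by rewrite inE => t; apply: weak_star_cvg; exact: rho_cont. Qed.

Let proj phi : X := CSpace (proj_in_cspace phi).

Let proj_linear : linear proj.
Proof.
move=> c phi psi; apply/val_inj/funext => t.
transitivity (rho t (c *: restr phi + restr psi)); last exact: linearP.
by congr (rho t _); exact/val_inj/funext.
Qed.

(** Weak-star continuity of [rho] makes [proj phi] continuous, norm one makes [Q] contractive, and
    the extension property at [J a] makes [Q] a left inverse. *)
Lemma bidual_retraction : exists Q : {linear dual (dual X) -> X},
  (forall phi, `|Q phi| <= `|phi|) /\ forall a, Q (canonical_embedding a) = a.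
Proof.
pose Q : {linear dual (dual X) -> X} :=
  HB.pack proj (GRing.isLinear.Build F _ _ _ proj proj_linear).
exists Q; split=> [phi|a] /=.
  apply: cspace_norm_le => // t; rewrite /proj/=.
  apply: (le_trans (ler_dual_norm _ _)); rewrite (rhoE t).2 mul1r.
  apply: dual_norm_le => // y; apply: (le_trans (ler_dual_norm phi (ev y))).
  exact: (ler_wpM2l (normr_ge0 _) (ev_le y)).
apply/val_inj/funext => t /=.
have -> : restr (canonical_embedding a) = J a by exact/val_inj/funext.
exact: (rhoE t).1.
Qed.

End bidual_projection.

Section retraction_complemented.
Context {R : realType} {s : scalars} {X : normedModType (scalar_field R s)}.
Local Notation F := (scalar_field R s).

Lemma canonical_embedding_linear : linear (@canonical_embedding R s X).
Proof. by move=> c x y; apply/val_inj/funext => f /=; rewrite linearP. Qed.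

Lemma norm_canonical_embedding_le (x : X) : `|canonical_embedding x| <= `|x|.
Proof. by apply: dual_norm_le => // f /=; rewrite mulrC ler_dual_norm. Qed.

Lemma continuous_norm_le (V W : normedModType F) (f : {linear V -> W}) (M : F) :
  0 <= M -> (forall x, `|f x| <= M * `|x|) -> continuous f.
Proof.
move=> M0 fM; apply: bounded_linear_continuous; apply/linear_boundedP.
near=> r => x; rewrite (le_trans (fM x))// ler_wpM2r//.
by near: r; apply: nbhs_pinfty_ge; exact: ger0_real.
Unshelve. all: by end_near. Qed.

(** The projection is [Q] followed by the canonical embedding. *)
Lemma retraction_complemented (Q : {linear dual (dual X) -> X}) (M : F) : 0 <= M ->
  (forall phi, `|Q phi| <= M * `|phi|) ->
  (forall x, Q (canonical_embedding x) = x) -> complemented_in_bidual X.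
Proof.
move=> M0 QM Qx.
pose P phi := canonical_embedding (Q phi).
have lP : linear P by move=> c f h; rewrite /P linearP canonical_embedding_linear.
pose P' : {linear dual (dual X) -> dual (dual X)} :=
  HB.pack P (GRing.isLinear.Build F _ _ _ P lP).
exists P'; split.
- apply: (@continuous_norm_le _ _ P' M M0) => phi.
  exact: le_trans (norm_canonical_embedding_le _) (QM phi).
- by move=> f; rewrite /= /P Qx.
- apply/seteqP; split=> [_ [phi _ <-]|_ [x _ <-]]; first by exists (Q phi).
  by exists (canonical_embedding x) => //; rewrite /= /P Qx.
Qed.

End retraction_complemented.

(** * Operators given by weakly unconditionally Cauchy series *)

Section scalar_sums.
Context {R : realType} {s : scalars}.
Local Notation F := (scalar_field R s).
Implicit Types (w : nat -> F) (M : F).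

Definition scalar_sum w : F := lim ((fun n => \sum_(k < n) w k : F^o) @ \oo).

Lemma real_series_cvg (w : nat -> R) (C : R) :
  (forall n, \sum_(k < n) `|w k| <= C) -> cvg ((fun n => \sum_(k < n) w k) @ \oo).
Proof.
move=> wC.
have h : cvgn (series w).
  apply: normed_cvg; apply: nondecreasing_is_cvgn.
    by apply: nondecreasing_series => n _ _; exact: normr_ge0.
  exists C => _ [n _ <-]; apply: le_trans (wC n).
  by rewrite -(big_mkord xpredT (fun k => `|w k|)).
rewrite (_ : (fun n => _) = series w)//; apply/funext => n.
by rewrite -(big_mkord xpredT w).
Qed.

Lemma rpart_sum w n : rpart (\sum_(k < n) w k) = \sum_(k < n) rpart (w k).
Proof.
elim: n => [|n IH]; last by rewrite !big_ord_recr/= rpartD IH.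
by rewrite !big_ord0 -[X in rpart X](@ofreal0 R s) rpart_ofreal.
Qed.

Lemma ipart_sum w n : ipart (\sum_(k < n) w k) = \sum_(k < n) ipart (w k).
Proof.
elim: n => [|n IH]; last by rewrite !big_ord_recr/= ipartD IH.
by rewrite !big_ord0 -[X in ipart X](subrr (0 : F)) ipartB subrr.
Qed.

(** Absolute convergence, reduced to real series through real and imaginary parts. *)
Lemma scalar_sum_cvg w M : (forall n, \sum_(k < n) `|w k| <= M) ->
  (fun n => \sum_(k < n) w k : F^o) @ \oo --> (scalar_sum w : F^o).
Proof.
move=> wM; have M0 : 0 <= M by have := wM 0%N; rewrite big_ord0.
have sumE n : \sum_(k < n) `|w k| = ofreal s (\sum_(k < n) modulus (w k)).
  elim: n => [|n IH]; first by rewrite !big_ord0 ofreal0.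
  by rewrite !big_ord_recr/= IH ofrealD ofreal_modulus.
have wM' n : \sum_(k < n) modulus (w k) <= modulus M.
  by rewrite -(@ler_ofreal R s) -sumE -ofreal_ge0P.
have rM n : \sum_(k < n) `|rpart (w k)| <= modulus M.
  by apply: le_trans (wM' n); apply: ler_sum => k _; exact: ler_rpart_modulus.
have iM n : \sum_(k < n) `|ipart (w k)| <= modulus M.
  by apply: le_trans (wM' n); apply: ler_sum => k _; exact: ler_ipart_modulus.
have /cvg_ex[a ra] := real_series_cvg (w := fun k => rpart (w k)) rM.
have /cvg_ex[b ib] := real_series_cvg (w := fun k => ipart (w k)) iM.
apply/cvg_ex; exists (ofreal s a + iunit * ofreal s b : F^o).
rewrite (_ : (fun n => _) = fun n => (ofreal s (\sum_(k < n) rpart (w k)) : F^o) +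
  (iunit : F^o) * (ofreal s (\sum_(k < n) ipart (w k)) : F^o)); last first.
  by apply/funext => n; rewrite {1}(partsE (\sum_(k < n) w k)) rpart_sum ipart_sum.
apply: (@cvgD _ F^o); last apply: (@cvgMr F _ \oo).
  exact: (cvg_comp _ _ ra (@ofreal_continuous R s a)).
exact: (cvg_comp _ _ ib (@ofreal_continuous R s b)).
Qed.

Lemma scalar_sum_eq w l :
  (fun n => \sum_(k < n) w k : F^o) @ \oo --> (l : F^o) -> scalar_sum w = l.
Proof. by move=> wl; apply: (cvg_lim (@norm_hausdorff F F^o) wl). Qed.

Lemma scalar_sum_linear (c : F) (v w : nat -> F) (M N : F) :
  (forall n, \sum_(k < n) `|v k| <= M) ->
  (forall n, \sum_(k < n) `|w k| <= N) ->
  scalar_sum (fun k => c * v k + w k) = c * scalar_sum v + scalar_sum w.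
Proof.
move=> vM wN; apply: scalar_sum_eq.
rewrite (_ : (fun n => _) = fun n => (c : F^o) * (\sum_(k < n) v k : F^o) +
  (\sum_(k < n) w k : F^o)); last first.
  by apply/funext => n; rewrite big_split/= mulr_sumr.
apply: (@cvgD _ F^o); last exact: scalar_sum_cvg wN.
by apply: (@cvgMr F _ \oo); exact: scalar_sum_cvg vM.
Qed.

Lemma scalar_sum_le w M : (forall n, \sum_(k < n) `|w k| <= M) ->
  `|scalar_sum w| <= M.
Proof.
move=> wM; have M0 : 0 <= M by have := wM 0%N; rewrite big_ord0.
rewrite (ofreal_ge0P M0) ler_norm_ofreal; apply/ler_addgt0Pr => e e0.
have /cvg_scalarP/(_ e e0)[N _ /(_ N (leqnn N))/= NP] := scalar_sum_cvg wM.
rewrite -[scalar_sum w](subrK (\sum_(k < N) w k)) addrC.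
rewrite (le_trans (modulusD _ _))// lerD// -ler_norm_ofreal -ofreal_ge0P//.
exact: le_trans (ler_norm_sum _ _ _) (wM N).
Qed.

Lemma scalar_sum1 w n : (forall k, k != n -> w k = 0) -> scalar_sum w = w n.
Proof.
move=> wn; apply: scalar_sum_eq; apply/cvg_scalarP => e e0.
exists n.+1 => // m /= nm; rewrite (bigD1 (Ordinal nm))//= big1 => [|i /wn//].
by rewrite addr0 subrr -(@ofreal0 R s) modulus_ofreal normr0 ltW.
Qed.

End scalar_sums.

Section real_functions.
Context {R : realType} {s : scalars} {K : compactHausdorffType}.
Local Notation F := (scalar_field R s).
Local Notation X := (cspace R s K).

(* Junk value [0] when [a] is not continuous. *)
Definition of_real_fun (a : K -> R) : X :=
  insubd (0 : X) (fun t => ofreal s (a t) : F^o).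

Lemma of_real_funE (a : K -> R) t : continuous a -> of_real_fun a t = ofreal s (a t).
Proof.
move=> ca; rewrite /of_real_fun.
have h : (fun t => ofreal s (a t) : F^o) \in @cspace_pred R s K.
  by rewrite inE => x; apply: continuous_comp; [exact: ca|exact: ofreal_continuous].
by have /(congr1 (@^~ t)) := insubdK (0 : X) h.
Qed.

Lemma rpart_cspace_continuous (a : X) : continuous (fun t => rpart (a t) : R).
Proof.
move=> t; apply: continuous_comp; first exact: cspace_continuous.
exact: rpart_continuous.
Qed.

Lemma ipart_cspace_continuous (a : X) : continuous (fun t => ipart (a t) : R).
Proof.
move=> t; apply: continuous_comp; first exact: cspace_continuous.
exact: ipart_continuous.
Qed.

End real_functions.

Lemma continuous_function_algebra (R : realType) (K : compactHausdorffType) :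
  function_algebra (fun a : K -> R => continuous a).
Proof.
split=> [c|a b ca cb|a b ca cb|a ca|a ca].
- exact: cst_continuous.
- by move=> t; apply: (@cvgD _ R); [exact: ca|exact: cb].
- by move=> t; apply: cvgM; [exact: ca|exact: cb].
- by move=> t; apply: (@cvg_norm _ R); exact: ca.
have [M aM] := cspace_modulus_bounded (of_real_fun (s := RealScalars) a).
exists M => t; have := aM t I; rewrite of_real_funE//.
Qed.

Section wuc_operator.
Context {R : realType} {s : scalars} {K : compactHausdorffType}.
Local Notation F := (scalar_field R s).
Local Notation X := (cspace R s K).
Variable Q : {linear dual (dual X) -> X}.
Hypothesis Q_le : forall phi, `|Q phi| <= `|phi|.
Hypothesis QK : forall a, Q (canonical_embedding a) = a.
Variables (c : nat -> K -> R) (B : R).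
Hypothesis c_cont : forall k, continuous (c k).
Hypothesis B0 : 0 <= B.
Hypothesis cB : forall n t, \sum_(k < n) `|c k t| <= B.

Let cc k : X := of_real_fun (c k).

(** As in [wuc_functional_sum], phases align the values of [f], and the combination has norm at most
    [B]. *)
Let sum_le (f : dual X) n : \sum_(k < n) `|f (cc k)| <= ofreal s B * `|f|.
Proof.
have [w [fw wc]] : exists w : X, f w = \sum_(k < n) `|f (cc k)| /\
    forall t, modulus (w t) <= \sum_(k < n) `|c k t|.
  elim: n => [|n [w [fw wc]]].
    exists 0; rewrite linear0 big_ord0; split=> // t.
    by rewrite big_ord0 -ler_norm_ofreal ofreal0 normr0.
  have [a a1 af] := phaseP (f (cc n)).
  exists (a *: cc n + w); split.
    transitivity (a * f (cc n) + f w); first exact: linearP.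
    by rewrite fw af big_ord_recr/= addrC.
  move=> t; rewrite big_ord_recr/= addrC.
  apply: (le_trans (modulusD _ _)); apply: lerD => //.
  rewrite modulusM /cc of_real_funE// modulus_ofreal ler_piMl//.
  by rewrite -ler_norm_ofreal ofreal1.
rewrite -[leLHS]ger0_norm ?sumr_ge0// -fw.
apply: (le_trans (ler_dual_norm f w)); rewrite mulrC ler_wpM2r//.
apply: cspace_norm_le => [|t]; first by rewrite -(@ofreal0 R s) ler_ofreal.
by rewrite ler_norm_ofreal (le_trans (wc t)).
Qed.

Let term_le (u : linfty R s) (f : dual X) n :
  \sum_(k < n) `|u k * f (cc k)| <= `|u| * (ofreal s B * `|f|).
Proof.
apply: le_trans (_ : `|u| * \sum_(k < n) `|f (cc k)| <= _); last first.
  by rewrite ler_wpM2l.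
rewrite mulr_sumr ler_sum// => k _; rewrite normrM ler_wpM2r//.
by apply: modulus_le_supnorm => //; exact: linfty_modulus_bounded.
Qed.

Let wuc_in_dual (u : linfty R s) :
  (fun f : dual X => scalar_sum (fun k => u k * f (cc k)) : F^o)
    \in @dual_pred R s (dual X).
Proof.
apply: (@bounded_in_dual _ _ _ _ (`|u| * ofreal s B)).
- move=> a f h; rewrite -[RHS](scalar_sum_linear a (term_le u f) (term_le u h)).
  by congr scalar_sum; apply/funext => k; rewrite mulrDr mulrCA.
- by rewrite mulr_ge0// -(@ofreal0 R s) ler_ofreal.
- by move=> f; rewrite -mulrA; exact: scalar_sum_le (term_le u f).
Qed.

Let wuc_dual u : dual (dual X) := Dual (wuc_in_dual u).

Let wuc_op u := Q (wuc_dual u).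

Let wuc_op_linear : linear wuc_op.
Proof.
move=> a u v; rewrite /wuc_op -linearP; congr (Q _).
apply/val_inj/funext => f.
transitivity (a * scalar_sum (fun k => u k * f (cc k)) +
  scalar_sum (fun k => v k * f (cc k))); last by [].
rewrite -(scalar_sum_linear a (term_le u f) (term_le v f)) /=.
by congr scalar_sum; apply/funext => k; rewrite mulrA -mulrDl.
Qed.

Lemma wuc_operator : exists S : {linear linfty R s -> X},
  (forall u, `|S u| <= ofreal s B * `|u|) /\
  forall n (u : linfty R s), (forall k, u k = (k == n)%:R) ->
    S u = of_real_fun (c n).
Proof.
pose S : {linear linfty R s -> X} :=
  HB.pack wuc_op (GRing.isLinear.Build F _ _ _ wuc_op wuc_op_linear).
exists S; split=> [u|n u un].
  apply: (le_trans (Q_le _)); apply: dual_norm_le => [|f].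
    by rewrite mulr_ge0// -(@ofreal0 R s) ler_ofreal.
  by rewrite [ofreal _ _ * _]mulrC -mulrA; exact: scalar_sum_le (term_le u f).
(* On a unit vector the element of the bidual is the canonical image of [of_real_fun (c n)]. *)
rewrite /= /wuc_op -[RHS]QK; congr (Q _); apply/val_inj/funext => f /=.
rewrite (@scalar_sum1 _ _ _ n) ?un ?eqxx ?mul1r// => k kn.
by rewrite un (negbTE kn) mul0r.
Qed.

End wuc_operator.

Section linfty_sequences.
Context {R : realType} {s : scalars}.
Local Notation F := (scalar_field R s).

(* Junk value [0] when [u] is unbounded. *)
Definition linfty_of (u : nat -> F) : linfty R s :=
  insubd (0 : linfty R s) (u : nat -> F^o).

Lemma linfty_ofE u : bounded_seq u -> linfty_of u =1 u.
Proof.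
move=> [M M0 uM] n; have h : (u : nat -> F^o) \in @linfty_pred R s.
  apply/linfty_predP; exists (modulus M) => k _.
  by rewrite -ler_norm_ofreal -ofreal_ge0P.
by have /(congr1 (@^~ n)) := insubdK (0 : linfty R s) h.
Qed.

Lemma linfty_norm_le (u : linfty R s) (M : F) : 0 <= M ->
  (forall n, `|u n| <= M) -> `|u| <= M.
Proof.
move=> M0 uM; rewrite (ofreal_ge0P M0); apply: supnorm_le => [|n _].
  exact: modulus_ge0.
by rewrite -ler_norm_ofreal -ofreal_ge0P.
Qed.

Lemma ler_linfty_norm (u : linfty R s) n : `|u n| <= `|u|.
Proof. by apply: modulus_le_supnorm => //; exact: linfty_modulus_bounded. Qed.

End linfty_sequences.

(** Real sequences are viewed in [linfty] and the real part of the image is taken; the real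
    functions [c n] are unaffected. *)
Lemma retraction_wuc_extension (R : realType) (s : scalars) (K : compactHausdorffType)
    (Q : {linear dual (dual (cspace R s K)) -> cspace R s K}) :
  (forall phi, `|Q phi| <= `|phi|) ->
  (forall a, Q (canonical_embedding a) = a) ->
  wuc_extension (fun a : K -> R => continuous a).
Proof.
move=> Q_le QK c B c_cont cB.
have cB' n t : \sum_(k < n) `|c k t| <= `|B| by exact: le_trans (cB n t) (ler_norm B).
have [S [S_le Sd]] := wuc_operator Q_le QK c_cont (normr_ge0 B) cB'.
pose emb (u : nat -> R) : linfty R s := linfty_of (fun n => ofreal s (u n)).
have ofreal_bounded (u : nat -> R) : bounded_seq u ->
    bounded_seq (fun n => ofreal s (u n)).
  move=> [M M0 uM]; exists (ofreal s M); first by rewrite -(@ofreal0 R s) ler_ofreal.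
  by move=> n; rewrite ler_norm_ofreal modulus_ofreal.
have embE u n : bounded_seq u -> emb u n = ofreal s (u n).
  by move=> bu; rewrite /emb linfty_ofE//; exact: ofreal_bounded.
exists (fun u t => rpart (S (emb u) t)), `|B|; split=> //.
- by move=> u _; exact: rpart_cspace_continuous.
- move=> r u v bu bv; apply/funext => t.
  have -> : emb (fun n => r * u n + v n) = ofreal s r *: emb u + emb v.
    apply/val_inj/funext => n.
    transitivity (ofreal s r * emb u n + emb v n); last by [].
    rewrite [LHS]embE ?embE ?ofrealD ?ofrealM//; exact: bounded_seqZD.
  rewrite linearP.
  transitivity (rpart (ofreal s r * S (emb u) t + S (emb v) t)); first by [].
  by rewrite rpartD rpartZ.
- move=> u M M0 uM t; apply: (le_trans (ler_rpart_modulus _)).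
  rewrite -ler_norm_ofreal ofrealM; apply: (le_trans (ler_cspace_norm _ t)).
  apply: (le_trans (S_le _)); rewrite ler_wpM2l//.
    by rewrite -(@ofreal0 R s) ler_ofreal.
  apply: linfty_norm_le => [|n]; first by rewrite -(@ofreal0 R s) ler_ofreal.
  by rewrite embE ?ler_norm_ofreal ?modulus_ofreal//; exists M.
- move=> n; apply/funext => t.
  rewrite (Sd n) ?of_real_funE ?rpart_ofreal// => k.
  rewrite embE; last by exists 1 => // i; case: eqP; rewrite ?normr1 ?normr0.
  by case: eqP => _; rewrite ?ofreal1 ?ofreal0.
Qed.

(** * The Grothendieck property *)

Section grothendieck.
Context {R : realType} {s : scalars} {K : compactHausdorffType}.
Local Notation F := (scalar_field R s).
Local Notation X := (cspace R s K).
Let A : set (K -> R) := fun a => continuous a.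
Let hA : function_algebra A := continuous_function_algebra R K.

Lemma rpartM (z w : F) : rpart (z * w) = rpart z * rpart w - ipart z * ipart w.
Proof.
rewrite /rpart /ipart; move: z w; case: s => [z w|[a b] [c d]]//=.
by rewrite mul0r subr0.
Qed.

Lemma ipartM (z w : F) : ipart (z * w) = rpart z * ipart w + ipart z * rpart w.
Proof.
rewrite /rpart /ipart; move: z w; case: s => [z w|[a b] [c d]]//=.
by rewrite mulr0 mul0r addr0.
Qed.

Let parts_mul (c : F) (x y : R) :
  ofreal s (rpart c * x - ipart c * y) +
  iunit * ofreal s (rpart c * y + ipart c * x) =
  c * (ofreal s x + iunit * ofreal s y).
Proof.
rewrite /rpart /ipart /iunit; move: c; case: s => [c|[a b]]/=.
  by rewrite !mul0r subr0 !addr0.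
by simpc.
Qed.

(** The scalar-linear extension of a real functional; over the reals the second term is zero. *)
Definition functional_ext (h : (K -> R) -> R) (a : X) : F^o :=
  ofreal s (h (fun t => rpart (a t))) + iunit * ofreal s (h (fun t => ipart (a t))).

Lemma functional_ext_linear h : linear_on A h -> linear (functional_ext h).
Proof.
move=> lh c a b; rewrite /functional_ext.
have Ar x : A (fun t => rpart ((x : X) t)) by exact: rpart_cspace_continuous.
have Ai x : A (fun t => ipart ((x : X) t)) by exact: ipart_cspace_continuous.
have hr : h (fun t => rpart ((c *: a + b) t)) =
    rpart c * h (fun t => rpart (a t)) - ipart c * h (fun t => ipart (a t)) +
    h (fun t => rpart (b t)).
  have e : (fun t => rpart ((c *: a + b) t)) = fun t => rpart c * rpart (a t) +
      (- ipart c * ipart (a t) + rpart (b t)).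
    apply/funext => t; transitivity (rpart (c * a t + b t)); first by [].
    by rewrite rpartD rpartM; ring.
  have Ab : A (fun t => - ipart c * ipart (a t) + rpart (b t)).
    by have := Ai a; have := Ar b => ? ?; fa.
  by rewrite e lh// lh//; ring.
have hi : h (fun t => ipart ((c *: a + b) t)) =
    rpart c * h (fun t => ipart (a t)) + ipart c * h (fun t => rpart (a t)) +
    h (fun t => ipart (b t)).
  have e : (fun t => ipart ((c *: a + b) t)) = fun t => rpart c * ipart (a t) +
      (ipart c * rpart (a t) + ipart (b t)).
    apply/funext => t; transitivity (ipart (c * a t + b t)); first by [].
    by rewrite ipartD ipartM; ring.
  have Ab : A (fun t => ipart c * rpart (a t) + ipart (b t)).
    by have := Ar a; have := Ai b => ? ?; fa.
  by rewrite e lh// lh//; ring.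
rewrite hr hi !ofrealD mulrDr addrACA -!ofrealD.
by rewrite [X in X + _]parts_mul.
Qed.

Lemma functional_ext_le h C a : norm_bound A h C ->
  modulus (functional_ext h a) <= 2 * C * modulus (`|a|).
Proof.
move=> hC; have bnd t : modulus (a t) <= modulus (`|a|).
  by rewrite -ler_norm_ofreal -ofreal_ge0P// ler_cspace_norm.
rewrite (_ : 2 * C * modulus _ = C * modulus (`|a|) + C * modulus (`|a|)); last by ring.
apply: (le_trans (modulusD _ _)); apply: lerD.
  rewrite modulus_ofreal; apply: hC; first exact: modulus_ge0.
    exact: rpart_cspace_continuous.
  by move=> t; exact: le_trans (ler_rpart_modulus _) (bnd t).
rewrite modulusM modulus_ofreal -[leRHS]mul1r ler_pM ?modulus_ge0//.
  exact: modulus_iunit.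
apply: hC; [exact: modulus_ge0|exact: ipart_cspace_continuous|] => t.
exact: le_trans (ler_ipart_modulus _) (bnd t).
Qed.

(** Junk value [0] when the extension of [h] is not in the dual. *)
Definition dual_ext (h : (K -> R) -> R) : dual X :=
  insubd (0 : dual X) (functional_ext h).

Lemma dual_extE h a : bounded_functional A h -> dual_ext h a = functional_ext h a.
Proof.
move=> [lh [C C0 hC]]; have hd : functional_ext h \in @dual_pred R s X.
  apply: (@bounded_in_dual _ _ _ _ (ofreal s (2 * C))).
  - exact: functional_ext_linear.
  - by rewrite -(@ofreal0 R s) ler_ofreal mulr_ge0.
  - move=> x; rewrite [`|x|]ofreal_ge0P// -ofrealM ler_norm_ofreal.
    exact: functional_ext_le.
by have /(congr1 (@^~ a)) := insubdK (0 : dual X) hd.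
Qed.

Lemma dual_ext_le h C : linear_on A h -> 0 <= C -> norm_bound A h C ->
  `|dual_ext h| <= ofreal s (2 * C).
Proof.
move=> lh C0 hC; apply: dual_norm_le => [|x].
  by rewrite -(@ofreal0 R s) ler_ofreal mulr_ge0.
rewrite dual_extE; last by split=> //; exists C.
rewrite [`|x|]ofreal_ge0P// -ofrealM ler_norm_ofreal.
exact: functional_ext_le.
Qed.

Lemma of_real_fun_linear c (a b : K -> R) : A a -> A b ->
  of_real_fun (s := s) (fun t => c * a t + b t) =
  ofreal s c *: of_real_fun a + of_real_fun b.
Proof.
move=> Aa Ab; apply/val_inj/funext => t.
transitivity (ofreal s c * of_real_fun a t + of_real_fun b t); last by [].
rewrite [LHS]of_real_funE; last by fa.
by rewrite !of_real_funE// ofrealD ofrealM.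
Qed.

Lemma of_real_fun_le (a : K -> R) (M : R) : 0 <= M -> A a ->
  (forall t, `|a t| <= M) -> `|of_real_fun (s := s) a| <= ofreal s M.
Proof.
move=> M0 Aa aM; apply: cspace_norm_le => [|t].
  by rewrite -(@ofreal0 R s) ler_ofreal.
by rewrite of_real_funE// ler_norm_ofreal modulus_ofreal.
Qed.

Let part_bounded (part : F -> R) (f : dual X) :
  (forall z w, part (z + w) = part z + part w) ->
  (forall r z, part (ofreal s r * z) = r * part z) ->
  (forall z, `|part z| <= modulus z) ->
  bounded_functional A (fun a => part (f (of_real_fun a))).
Proof.
move=> partD partZ part_le; split=> [c a b Aa Ab|].
  rewrite of_real_fun_linear//.
  transitivity (part (ofreal s c * f (of_real_fun a) + f (of_real_fun b))).
    by congr part; exact: linearP.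
  by rewrite partD partZ.
exists (modulus (`|f|)) => [|a M M0 Aa aM]; first exact: modulus_ge0.
apply: (le_trans (part_le _)); rewrite -ler_norm_ofreal ofrealM -ofreal_ge0P//.
apply: (le_trans (ler_dual_norm _ _)); rewrite ler_wpM2l//.
exact: of_real_fun_le.
Qed.

(** The factor 2 comes from [dual_ext_le]; the added 1 makes the constant positive even for
    [phi = 0]. *)
Let part_bidual (part : F -> R) (phi : dual (dual X)) :
  (forall z w, part (z + w) = part z + part w) ->
  (forall r z, part (ofreal s r * z) = r * part z) ->
  (forall z, `|part z| <= modulus z) ->
  bidual_form A (2 * modulus (`|phi|) + 1) (fun h => part (phi (dual_ext h))).
Proof.
move=> partD partZ part_le; split=> [c u v w bu bv wE|u C lu C0 uC].
  have bw : bounded_functional A w.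
    have [lu [C C0 uC]] := bu; have [lv [D D0 vD]] := bv.
    split=> [r a b Aa Ab|].
      by rewrite !wE ?lu ?lv//; [ring|fa].
    exists (`|c| * C + D) => [|a M M0 Aa aM]; first by rewrite addr_ge0// mulr_ge0.
    rewrite wE// (le_trans (ler_normD _ _))// mulrDl lerD//; last exact: vD.
    by rewrite normrM -mulrA ler_wpM2l//; exact: uC.
  have -> : dual_ext w = ofreal s c *: dual_ext u + dual_ext v.
    apply/val_inj/funext => a.
    transitivity (ofreal s c * dual_ext u a + dual_ext v a); last by [].
    rewrite [LHS]dual_extE// !dual_extE// /functional_ext !wE.
    - by rewrite !ofrealD !ofrealM; ring.
    - exact: ipart_cspace_continuous.
    - exact: rpart_cspace_continuous.
  transitivity (part (ofreal s c * phi (dual_ext u) + phi (dual_ext v))).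
    by congr part; exact: linearP.
  by rewrite partD partZ.
apply: (le_trans (part_le _)).
apply: (@le_trans _ _ (modulus (`|phi|) * (2 * C))); last by lra.
rewrite -ler_norm_ofreal ofrealM -ofreal_ge0P//.
apply: (le_trans (ler_dual_norm _ _)); rewrite ler_wpM2l//.
exact: dual_ext_le.
Qed.

Lemma wuc_extension_grothendieck : wuc_extension A -> grothendieck_property X.
Proof.
move=> extA u f uf; apply: weak_cvg => phi; apply/cvg_scalarP => e e0.
pose d n := f - u n.
have d0 a e' : 0 < e' -> exists N, forall n, (N <= n)%N -> modulus (d n a) <= e'.
  move=> e'0; have ua : (fun n => u n a) @ \oo --> f a by exact: weak_star_cvg uf a.
  have [N _ NP] := (cvg_scalarP _ _ _).1 ua _ e'0.
  by exists N => n /NP.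
pose g1 n (a : K -> R) := rpart (d n (of_real_fun a)) : R.
pose g2 n (a : K -> R) := ipart (d n (of_real_fun a)) : R.
have b1 n : bounded_functional A (g1 n).
  exact: part_bounded (@rpartD R s) (@rpartZ R s) (@ler_rpart_modulus R s).
have b2 n : bounded_functional A (g2 n).
  exact: part_bounded (@ipartD R s) (@ipartZ R s) (@ler_ipart_modulus R s).
have z1 a : A a -> forall e, 0 < e ->
    exists N, forall n, (N <= n)%N -> `|g1 n a| <= e.
  move=> Aa e' /(d0 (of_real_fun a))[N NP]; exists N => n Nn.
  exact: le_trans (ler_rpart_modulus _) (NP n Nn).
have z2 a : A a -> forall e, 0 < e ->
    exists N, forall n, (N <= n)%N -> `|g2 n a| <= e.
  move=> Aa e' /(d0 (of_real_fun a))[N NP]; exists N => n Nn.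
  exact: le_trans (ler_ipart_modulus _) (NP n Nn).
have M0 : 0 < 2 * modulus (`|phi|) + 1.
  by rewrite ltr_wpDl// mulr_ge0// modulus_ge0.
have Phi1 := part_bidual phi (@rpartD R s) (@rpartZ R s) (@ler_rpart_modulus R s).
have Phi2 := part_bidual phi (@ipartD R s) (@ipartZ R s) (@ler_ipart_modulus R s).
(* The real and imaginary parts of [phi] are applied to those of [d n], which makes four real
   problems. *)
have e4 : 0 < e / 4 by rewrite divr_gt0.
have [N1 P1] := weak_null hA extA b1 z1 M0 Phi1 e4.
have [N2 P2] := weak_null hA extA b1 z1 M0 Phi2 e4.
have [N3 P3] := weak_null hA extA b2 z2 M0 Phi1 e4.
have [N4 P4] := weak_null hA extA b2 z2 M0 Phi2 e4.
exists (maxn (maxn N1 N2) (maxn N3 N4)) => // n /=.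
rewrite !geq_max => /andP[/andP[n1 n2] /andP[n3 n4]].
(* A functional is recovered from the real and imaginary parts of its restriction to real
   functions. *)
have dE : d n = (iunit : F) *: dual_ext (g2 n) + dual_ext (g1 n).
  apply/val_inj/funext => a.
  transitivity ((iunit : F) * dual_ext (g2 n) a + dual_ext (g1 n) a); last by [].
  rewrite !dual_extE// /functional_ext /g1 /g2.
  set x := fun t => rpart (a t); set y := fun t => ipart (a t).
  have aE : a = (iunit : F) *: of_real_fun y + of_real_fun x.
    apply/val_inj/funext => t.
    transitivity ((iunit : F) * of_real_fun y t + of_real_fun x t); last by [].
    rewrite !of_real_funE; [|exact: rpart_cspace_continuous|
      exact: ipart_cspace_continuous].
    by rewrite addrC -partsE.
  transitivity ((iunit : F) * d n (of_real_fun y) + d n (of_real_fun x)).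
    by rewrite [in LHS]aE; exact: linearP.
  rewrite {1}(partsE (d n (of_real_fun y))) {1}(partsE (d n (of_real_fun x))).
  ring.
have -> : phi f - phi (u n) = (iunit : F) * phi (dual_ext (g2 n)) + phi (dual_ext (g1 n)).
  transitivity (phi (d n)); first by rewrite /d linearB.
  by rewrite dE; exact: linearP.
have -> : e = e / 4 + e / 4 + (e / 4 + e / 4) by field.
apply: (le_trans (modulusD _ _)); apply: lerD.
  rewrite modulusM; apply: (@le_trans _ _ (modulus (phi (dual_ext (g2 n))))).
    by rewrite ler_piMl ?modulus_ge0// modulus_iunit.
  by apply: modulus_parts; [exact: P3|exact: P4].
by apply: modulus_parts; [exact: P1|exact: P2].
Qed.

End grothendieck.

(** * Copies of [linfty] *)

Section isomorphic_copy.
Context {R : realType} {s : scalars} {X : normedModType (scalar_field R s)}.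
Local Notation F := (scalar_field R s).
Local Notation E := (linfty R s).

Lemma scalar_nested_limit (z : nat -> F) :
  (forall k, modulus (z k.+1 - z k) <= 3^-1 ^+ k) ->
  exists l, forall k, modulus (l - z k) <= 3 * 3^-1 ^+ k.
Proof.
move=> zk.
have rz k : `|rpart (z k.+1) - rpart (z k)| <= 3^-1 ^+ k.
  by rewrite -rpartB; exact: le_trans (ler_rpart_modulus _) (zk k).
have iz k : `|ipart (z k.+1) - ipart (z k)| <= 3^-1 ^+ k.
  by rewrite -ipartB; exact: le_trans (ler_ipart_modulus _) (zk k).
have [a aP] := nested_limit (x := fun k => rpart (z k)) rz.
have [b bP] := nested_limit (x := fun k => ipart (z k)) iz.
exists (ofreal s a + iunit * ofreal s b) => k.
rewrite {1}(partsE (z k)) opprD addrACA -mulrBr -!ofrealB.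
rewrite (le_trans (modulusD _ _))// modulusM !modulus_ofreal.
have h : modulus (iunit : F) * `|b - ipart (z k)| <= `|b - ipart (z k)|.
  by rewrite ler_piMl// modulus_iunit.
by have := aP k; have := bP k; lra.
Qed.

Variables (T : {linear E -> X}) (C D : R).
Hypotheses (C0 : 0 <= C) (D0 : 0 < D).
Hypothesis T_le : forall u, `|T u| <= ofreal s C * `|u|.
Hypothesis T_ge : forall u, `|u| <= ofreal s D * `|T u|.

Let oge0 (r : R) : 0 <= r -> 0 <= ofreal s r.
Proof. by move=> r0; rewrite -(@ofreal0 R s) ler_ofreal. Qed.

Let T_inj : injective T.
Proof.
move=> u v uv; apply/eqP; rewrite -subr_eq0 -normr_le0.
by apply: (le_trans (T_ge _)); rewrite linearB uv subrr normr0 mulr0.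
Qed.

Let closed_range : closed (range T).
Proof.
move=> x clx.
(* Chosen so that [D * (e k + e k)] is [3^-1 ^+ k], the step size that [scalar_nested_limit]
   accepts. *)
pose e (k : nat) : R := 3^-1 ^+ k / (2 * D).
have t0 k : 0 < 3^-1 ^+ k :> R by rewrite exprn_gt0.
have e0 k : 0 < e k by rewrite divr_gt0// mulr_gt0.
have /choice[u uP] k : exists u : E, `|x - T u| <= ofreal s (e k).
  have ek : 0 < ofreal s (e k).
    by rewrite lt0r oge0 ?ltW// -(@ofreal0 R s) (inj_eq (@ofreal_inj R s)) gt_eqF.
  have [_ [[u _ <-]]] := clx _ (nbhsx_ballx x _ ek).
  by rewrite -ball_normE => /ltW xu; exists u.
have uu k : `|u k.+1 - u k| <= ofreal s (3^-1 ^+ k).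
  apply: (le_trans (T_ge _)).
  have h : `|T (u k.+1 - u k)| <= ofreal s (e k + e k).
    have -> : T (u k.+1 - u k) = (x - T (u k)) - (x - T (u k.+1)).
      by rewrite linearB opprB [RHS]addrC addrA subrK.
    apply: (le_trans (ler_normB _ _)); rewrite ofrealD lerD//.
    apply: (le_trans (uP k.+1)); rewrite ler_ofreal.
    by rewrite ler_pM2r ?invr_gt0 ?mulr_gt0// exprS; have := t0 k; lra.
  apply: (le_trans (ler_wpM2l (oge0 (ltW D0)) h)).
  rewrite -ofrealM ler_ofreal /e le_eqVlt; apply/orP; left; apply/eqP.
  by field; rewrite gt_eqF.
(* The limit is taken coordinatewise; its rate does not depend on [i], so the convergence is in
   norm. *)
have /choice[l lP] i : exists l : F, forall k, modulus (l - u k i) <= 3 * 3^-1 ^+ k.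
  apply: (scalar_nested_limit (z := fun k => u k i)) => k.
  rewrite -ler_norm_ofreal; apply: le_trans (uu k).
  exact: (ler_linfty_norm (u k.+1 - u k) i).
have bl : bounded_seq l.
  exists (`|u 0%N| + ofreal s 3) => [|i]; first by rewrite addr_ge0// oge0.
  rewrite -(subrK (u 0%N i) (l i)) addrC (le_trans (ler_normD _ _))// lerD//.
    exact: ler_linfty_norm.
  by rewrite ler_norm_ofreal; have := lP i 0%N; rewrite expr0 mulr1.
pose w : E := linfty_of l.
have wu k : `|w - u k| <= ofreal s (3 * 3^-1 ^+ k).
  apply: linfty_norm_le => [|i]; first by rewrite oge0// mulr_ge0// ltW.
  rewrite (_ : (w - u k) i = l i - u k i) ?ler_norm_ofreal//.
  by rewrite -(linfty_ofE bl).
exists w => //; apply/eqP; rewrite eq_sym -subr_eq0 -normr_eq0.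
have small k : modulus (`|x - T w|) <= (1 / (2 * D) + C * 3) * 3^-1 ^+ k.
  rewrite -(@ler_ofreal R s) ofreal_modulus normr_id -(subrK (T (u k)) x) -addrA.
  apply: (le_trans (ler_normD _ _)).
  rewrite mulrDl ofrealD lerD//.
    apply: (le_trans (uP k)); rewrite ler_ofreal /e le_eqVlt.
    by apply/orP; left; apply/eqP; field; rewrite gt_eqF.
  rewrite -linearB; apply: (le_trans (T_le _)).
  by rewrite -mulrA ofrealM ler_wpM2l ?oge0// distrC.
suff : modulus (`|x - T w|) <= 0.
  rewrite -(@ler_ofreal R s) ofreal_modulus normr_id ofreal0 => h.
  by apply/eqP/le_anti; rewrite h normr_ge0.
apply/ler_addgt0Pr => d d0; rewrite add0r.
have [k _ kd] := half_pow_small (1 / (2 * D) + C * 3) 0 d0.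
apply: (le_trans (small k)); apply: le_trans kd.
rewrite ler_wpM2l//.
  by apply: addr_ge0; [rewrite divr_ge0// mulr_ge0// ltW|rewrite mulr_ge0].
by rewrite lerXn2r ?nnegrE ?invr_ge0// lef_pV2 ?posrE// ler_nat.
Qed.

(** By the lower bound, the inverse is Lipschitz with constant [D] on the range, and preimages of a
    convergent sequence converge, so the range is closed. Off the range, [S] takes the default value
    [0]. *)
Lemma bounded_below_copy : contains_copy_of_linfty X.
Proof.
pose S x := if pselect (exists u, T u = x) is left h then projT1 (cid h) else 0.
have TK : cancel T S.
  move=> u; rewrite /S; case: pselect => [h|[]]; last by exists u.
  by apply: T_inj; exact: projT2 (cid h).
exists T, S; split=> //.
  exact: (@continuous_norm_le _ _ _ _ T _ (oge0 C0) T_le).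
apply/subspace_continuousP => _ [u _ <-]; apply/cvgrPdist_le => e e0.
rewrite near_withinE.
have eD : 0 < e / ofreal s D.
  rewrite divr_gt0// lt0r oge0 ?ltW// -(@ofreal0 R s).
  by rewrite (inj_eq (@ofreal_inj R s)) gt_eqF.
have D1 : 0 < ofreal s D by move: eD; rewrite pmulr_rgt0// invr_gt0.
apply: filterS (nbhsx_ballx (T u) _ eD) => y yu [v _ vy].
rewrite /from_subspace -vy !TK; apply: (le_trans (T_ge _)).
rewrite mulrC -ler_pdivlMr// linearB vy ltW//.
by move: yu; rewrite -ball_normE.
Qed.

End isomorphic_copy.

(** * Disjoint bump functions *)

Section bump_functions.
Context {K : compactHausdorffType}.

(** Separate two points of [W] by [U] and [V]. If [W] meets [V] in an infinite set, that set is the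
    infinite piece; otherwise the intersection is finite, hence closed, and removing it from [W]
    leaves an infinite open set. *)
Let split_open (W : set K) : open W -> infinite_set W ->
  exists OW : set K * set K,
    [/\ [/\ open OW.1, OW.1 !=set0 & OW.1 `<=` W],
        [/\ open OW.2, infinite_set OW.2 & OW.2 `<=` W] & OW.1 `&` OW.2 = set0].
Proof.
move=> oW iW; have [x Wx] := infinite_setN0 iW.
have [y [Wy /= yx]] := infinite_setN0 (infinite_setD iW (finite_set1 x)).
have := @hausdorffT K; rewrite open_hausdorff.
have xy : x != y by apply/eqP => e; apply: yx.
move=> /(_ x y xy)[[U V] /= [/set_mem Ux /set_mem Vy] [oU oV /eqP UV]].
have [fWV|iWV] := pselect (finite_set (W `&` V)); last first.
  exists (W `&` U, W `&` V); split=> /=.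
  - by split; [exact: openI|exists x|exact: subIsetl].
  - by split; [exact: openI|exact: iWV|exact: subIsetl].
  - by rewrite setIACA UV setI0.
exists (W `&` V, W `\` (W `&` V)); split=> /=.
- by split; [exact: openI|exists y|exact: subIsetl].
- split; [|exact: infinite_setD|exact: subDsetl].
  rewrite setDE; apply: openI => //; rewrite openC.
  exact: (accessible_finite_set_closed.1 (hausdorff_accessible hausdorffT) _ fWV).
- by rewrite setDE setICA setICr setI0.
Qed.

(** The infinite piece is split again and again, and the other pieces are collected. *)
Lemma disjoint_open_sequence : infinite_set [set: K] ->
  exists O : nat -> set K, [/\ forall k, open (O k), forall k, O k !=set0 &
    forall j k, j != k -> O j `&` O k = set0].
Proof.
move=> iK.
have /choice[q qP] (W : set K) : exists OW : set K * set K,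
    open W /\ infinite_set W ->
    [/\ [/\ open OW.1, OW.1 !=set0 & OW.1 `<=` W],
        [/\ open OW.2, infinite_set OW.2 & OW.2 `<=` W] & OW.1 `&` OW.2 = set0].
  have [[oW iW]|nW] := pselect (open W /\ infinite_set W).
    by have [OW OWP] := split_open oW iW; exists OW.
  by exists (set0, set0).
pose W := fix W k := if k is k'.+1 then (q (W k')).2 else [set: K].
have Wk k : open (W k) /\ infinite_set (W k).
  elim: k => [|k IH] /=; first by split=> //; exact: openT.
  by have [_ []] := qP _ IH.
have Wsub j k : (j <= k)%N -> W k `<=` W j.
  move=> /subnKC <-; elim: (k - j)%N => [|m IH]; first by rewrite addn0.
  rewrite addnS; apply: subset_trans IH.
  by have [_ []] := qP _ (Wk (j + m)%N).
exists (fun k => (q (W k)).1); split=> [k|k|].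
- by have [[]] := qP _ (Wk k).
- by have [[]] := qP _ (Wk k).
have lt_disj j k : (j < k)%N -> (q (W j)).1 `&` (q (W k)).1 = set0.
  move=> jk; have [_ _ d] := qP _ (Wk j); have [[_ _ Ok] _ _] := qP _ (Wk k).
  by rewrite -subset0 -d; apply: setIS; exact: subset_trans Ok (Wsub _ _ jk).
by move=> j k; rewrite neq_ltn => /orP[/lt_disj//|/lt_disj]; rewrite setIC.
Qed.

(** Urysohn functions vanishing off disjoint open sets: at most one is nonzero at each point. *)
Lemma disjoint_bumps (R : realType) : infinite_set [set: K] ->
  exists (c : nat -> K -> R) (t : nat -> K), [/\ forall k, continuous (c k),
    forall k, c k (t k) = 1 & forall n x, \sum_(k < n) `|c k x| <= 1].
Proof.
move=> /disjoint_open_sequence[ O [oO O0 Odisj]].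
have /choice[t tO] k : exists x, O k x by exact: O0.
have nK : normal_space K by apply: compact_normal; [exact: hausdorffT|exact: compactT].
have /choice[c cP] k : exists c : K -> R, [/\ continuous c, c (t k) = 1,
    forall x, 0 <= c x <= 1 & forall x, ~ O k x -> c x = 0].
  have clt : closed [set t k].
    exact: (accessible_closed_set1 (hausdorff_accessible hausdorffT)).
  have d : ~` O k `&` [set t k] = set0.
    by rewrite -subset0 => x [/= + xt]; rewrite xt; apply; exact: tO.
  have := (@normal_separatorP R K).1 nK _ _ (open_closedC (oO k)) clt d.
  move=> /(@uniform_separatorP _ R)[f [cf f01 f0 f1]]; exists f; split=> //.
  - by apply: f1; exists (t k).
  - by move=> x; have := f01 (f x); rewrite /= in_itv/=; apply; exists x.
  - by move=> x Ox; apply: f0; exists x.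
exists c, t; split=> [k|k|n x]; [by case: (cP k)|by case: (cP k)|].
have [[j Oj]|no] := pselect (exists j : 'I_n, O j x).
  rewrite (bigD1 j)//= big1 ?addr0 => [|i ij].
    by have [_ _ /(_ x)/andP[? ?] _] := cP j; rewrite ger0_norm.
  have [_ _ _ ->] := cP i; first by rewrite normr0.
  by move=> Oi; have : (O i `&` O j) x by []; rewrite Odisj.
rewrite big1// => i _; have [_ _ _ ->] := cP i; first by rewrite normr0.
by move=> Oi; apply: no; exists i.
Qed.

End bump_functions.

(** * The copy of [linfty] in C(K) *)

Section copy_of_linfty.
Context {R : realType} {s : scalars} {K : compactHausdorffType}.
Local Notation F := (scalar_field R s).
Local Notation X := (cspace R s K).
Variable Q : {linear dual (dual X) -> X}.
Hypothesis Q_le : forall phi, `|Q phi| <= `|phi|.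
Hypothesis QK : forall a, Q (canonical_embedding a) = a.

(* The operator extending [e_k |-> c_k] to bounded sequences has the value
   [u_k + mu_k u'] at the peak of [c_k], where [u'] is [u] with its [k]-th term
   removed; [rosenthal] makes the second term small along a subsequence. *)
Lemma retraction_copy_of_linfty : infinite_set [set: K] ->
  contains_copy_of_linfty X.
Proof.
move=> /(disjoint_bumps R)[c [t [cc ct c1]]].
have [S [S_le Sd]] := wuc_operator Q_le QK cc ler01 c1.
have {}S_le u : `|S u| <= `|u| by have := S_le u; rewrite ofreal1 mul1r.
have ofD a (u v : nat -> F) : bounded_seq u -> bounded_seq v ->
    linfty_of (fun n => a * u n + v n) = a *: linfty_of u + linfty_of v :> linfty R s.
  move=> bu bv; apply/val_inj/funext => n.
  transitivity (a * linfty_of u n + linfty_of v n); last by [].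
  by rewrite [LHS]linfty_ofE ?linfty_ofE//; exact: bounded_seqZD.
pose mu n (u : nat -> F) : F := S (linfty_of u) (t n).
have lmu n : linear_on (@bounded_seq F) (mu n).
  by move=> a u v bu bv; rewrite /mu ofD// linearP.
(* The norm bound 1 is written as twice one half, the form that [rosenthal] takes with [2^-1] for
   [eps]. *)
have mu_le n (u : nat -> F) : (forall k, `|u k| <= 1) -> `|mu n u| <= 2%:R * 2^-1.
  move=> u1; rewrite divff ?pnatr_eq0//.
  apply: (le_trans (ler_cspace_norm _ _)); apply: (le_trans (S_le _)).
  by apply: linfty_norm_le => // k; rewrite linfty_ofE//; exists 1.
have h0 : 0 < 2^-1 :> F by rewrite invr_gt0.
have [m minj mP] := rosenthal h0 lmu mu_le.
have bl (u : linfty R s) : bounded_seq u.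
  by exists `|u| => // n; exact: ler_linfty_norm.
have ofK (u : linfty R s) : linfty_of u = u.
  by apply/val_inj/funext => n; exact: linfty_ofE.
pose T (u : linfty R s) := S (linfty_of (spread m u)).
have lT : linear T.
  move=> a u v; rewrite /T -linearP -ofD; try exact: bounded_spread.
  by rewrite -spread_linear.
pose T' : {linear linfty R s -> X} :=
  HB.pack T (GRing.isLinear.Build F _ _ _ T lT).
(* The lower constant is 2 because the off-diagonal terms cost at most half of the norm. *)
apply: (@bounded_below_copy _ _ _ T' 1 2) => // u.
  rewrite ofreal1 mul1r; apply: (le_trans (S_le _)).
  apply: linfty_norm_le => // n; rewrite linfty_ofE; last exact: bounded_spread.
  by apply: spread_le => // k; exact: ler_linfty_norm.
have [u0|un0] := eqVneq `|u| 0.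
  by rewrite u0 mulr_ge0// -(@ofreal0 R s) ler_ofreal.
have up : 0 < `|u| by rewrite lt0r un0/=.
have key k : `|u k| <= `|T u| + `|u| / 2.
  (* [u] without its [k]-th term, rescaled to the unit ball so that [mP] applies. *)
  pose v i : F := if i == k then 0 else u i / `|u|.
  have v1 i : `|v i| <= 1.
    rewrite /v; case: eqP => _; first by rewrite normr0.
    by rewrite normrM normfV normr_id ler_pdivrMr// mul1r ler_linfty_norm.
  have vk : v k = 0 by rewrite /v eqxx.
  pose d i : F := (i == m k)%:R.
  have bd : bounded_seq d.
    by exists 1 => // i; rewrite /d; case: eqP; rewrite ?normr1 ?normr0.
  have bv : bounded_seq (spread m v) by apply: bounded_spread; exists 1.
  have bz : bounded_seq (fun=> 0 : F) by exists 0 => // i; rewrite normr0.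
  have bw : bounded_seq (fun i => `|u| * spread m v i + 0) by exact: bounded_seqZD.
  have e : spread m u = fun i => u k * d i + (`|u| * spread m v i + 0).
    apply/funext => i; rewrite addr0.
    case: (spreadP m u i) => [j <-|mi].
      rewrite spreadE// /d /v (inj_eq minj); case: eqP => [->|_].
        by rewrite mulr1 mulr0 addr0.
      by rewrite mulr0 add0r mulrC divfK.
    rewrite spread_out// /d mulr0 addr0; case: eqP => [im|_]; last by rewrite mulr0.
    by case: (mi k).
  have mud : mu (m k) d = 1.
    rewrite /mu (Sd (m k)) => [|i]; last by rewrite linfty_ofE.
    by rewrite of_real_funE// ct ofreal1.
  have E : T u (t (m k)) = u k + `|u| * mu (m k) (spread m v).
    transitivity (mu (m k) (spread m u)); first by [].
    rewrite e lmu// lmu// mud mulr1; congr (_ + _).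
    by rewrite (linear_on0 bz (lmu _)) addr0.
  have -> : u k = T u (t (m k)) - `|u| * mu (m k) (spread m v) by rewrite E addrK.
  apply: (le_trans (ler_normB _ _)); apply: lerD; first exact: ler_cspace_norm.
  by rewrite normrM normr_id ler_wpM2l//; exact: mP.
have h : `|u| <= `|T u| + `|u| / 2.
  by apply: linfty_norm_le => //; rewrite addr_ge0// divr_ge0.
have e2 : ofreal s (2 : R) = 2.
  by transitivity (ofreal s (1 + 1 : R)); [|rewrite ofrealD ofreal1].
rewrite e2 -ler_pdivrMl//.
have -> : 2^-1 * `|u| = `|u| - `|u| / 2 by field.
by rewrite lerBlDr.
Qed.

End copy_of_linfty.

Theorem theorem2p7 (R : realType) (s : scalars)
    (Y : completeNormedModType (scalar_field R s)) (K : compactHausdorffType)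
    (J : {linear cspace R s K -> dual Y}) :
  infinite_set [set: K] ->
  isometric_closed_embedding J ->
  continuous_extension_property J ->
  [/\ complemented_in_bidual (cspace R s K),
      grothendieck_property (cspace R s K) &
      contains_copy_of_linfty (cspace R s K)].
Proof.
move=> infK [J_iso _] [rho [rho_cont rhoE]].
have [Q [Q_le QK]] := bidual_retraction J_iso rho_cont rhoE.
split.
- apply: (@retraction_complemented _ _ _ Q 1) => // phi.
  by rewrite mul1r.
- exact: wuc_extension_grothendieck (retraction_wuc_extension Q_le QK).
- exact: retraction_copy_of_linfty Q_le QK infK.
Qed.
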